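(* For every constant $g$, there is a polynomial-time (dynamic programming) algorithm that, given a ranking $\pi\in\mathcal{S}_d$, a partition of $[d]$ into $g$ groups $G_1,\dots,G_g$, vectors $\bar{\alpha},\bar{\beta}\in[0,1]^g$ and $k\in[d]$, finds a closest $(\bar{\alpha},\bar{\beta})$-strict-$k$-fair ranking to $\pi$ under the Ulam metric.
   Context: $\mathcal{S}_d$ is the set of rankings (permutations) of $[d]$. The Ulam distance $\mathcal{U}(\pi_1,\pi_2)$ is the minimum number of moves (removing one element and reinserting it at another position) transforming $\pi_1$ into $\pi_2$; equivalently $d-|\mathrm{LCS}(\pi_1,\pi_2)|$, where LCS is a longest common subsequence. A ranking $\pi$ is $(\bar{\alpha},\bar{\beta})$-strict-$k$-fair if for every prefix $P$ of $\pi$ with $|P|\ge k$ and every $i\in[g]$, $\lfloor\alpha_i|P|\rfloor\le|P\cap G_i|\le\lceil\beta_i|P|\rceil$. A closest such ranking minimizes $\mathcal{U}(\pi,\cdot)$ over all strict-$k$-fair rankings (assumed to exist). *)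

(* Defs.v *)
From HB Require Import structures.
From mathcomp Require Import all_boot all_order all_algebra all_fingroup.

Set Implicit Arguments.
Unset Strict Implicit.
Unset Printing Implicit Defensive.

Import Order.TTheory GRing.Theory Num.Theory.

Local Open Scope ring_scope.

(** * Rankings and the Ulam distance *)

(* A ranking of d candidates is pi : 'S_d, where pi i is the candidate placed
   at rank i; ranks and candidates are both numbered from 0. *)

Definition word (d : nat) (pi : 'S_d) : seq 'I_d := [seq pi i | i : 'I_d].

(* On a duplicate-free s containing x, j is the position of x afterwards. *)
Definition reinsert (T : eqType) (x : T) (j : nat) (s : seq T) : seq T :=
  take j (rem x s) ++ x :: drop j (rem x s).

(* The move that puts x back in its old position is allowed too; as it does
   nothing, it does not affect the minimum number of moves. *)
Definition ulam_move (d : nat) (pi sg : 'S_d) : bool :=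
  [exists x : 'I_d, exists j : 'I_d, word sg == reinsert x j (word pi)].

Fixpoint ulam_moves (d n : nat) (pi sg : 'S_d) : bool :=
  if n is m.+1 then [exists tau : 'S_d, ulam_move pi tau && ulam_moves m tau sg]
  else pi == sg.

Lemma ulam_moves_trans (d m n : nat) (pi tau sg : 'S_d) :
  ulam_moves m pi tau -> ulam_moves n tau sg -> ulam_moves (m + n) pi sg.
Proof.
elim: m pi => [|m IHm] pi /=; first by move/eqP->.
case/existsP=> rho /andP[mv_rho rho_tau] tau_sg; apply/existsP; exists rho.
by rewrite mv_rho IHm.
Qed.

Lemma size_word (d : nat) (pi : 'S_d) : size (word pi) = d.
Proof. by rewrite size_image card_ord. Qed.

Lemma word_uniq (d : nat) (pi : 'S_d) : uniq (word pi).
Proof. by rewrite map_inj_uniq ?enum_uniq //; apply: perm_inj. Qed.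

Lemma mem_word (d : nat) (pi : 'S_d) (x : 'I_d) : x \in word pi.
Proof. by rewrite -[x](permKV pi) image_f. Qed.

Lemma word_inj (d : nat) : injective (@word d).
Proof.
by move=> pi sg /eq_in_map eq_ps; apply/permP=> i; apply: eq_ps; rewrite mem_enum.
Qed.

Lemma nth_word (d : nat) (pi : 'S_d) (x i : 'I_d) : nth x (word pi) i = pi i.
Proof. by rewrite (nth_map i) ?size_enum_ord // nth_ord_enum. Qed.

Lemma perm_word (d : nat) (pi : 'S_d) (s : seq 'I_d) :
  perm_eq s (word pi) -> exists sg : 'S_d, word sg = s.
Proof.
move=> eq_s; have sz_s : size s == d by rewrite (perm_size eq_s) size_word.
have uniq_s : uniq s by rewrite (perm_uniq eq_s) word_uniq.
have inj_s : injective (tnth (Tuple sz_s)) by apply/tuple_uniqP.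
exists (perm inj_s); rewrite -[RHS](map_tnth_enum (Tuple sz_s)).
by apply: eq_map => i; rewrite permE.
Qed.

Lemma perm_reinsert (T : eqType) (x : T) (j : nat) (s : seq T) :
  x \in s -> perm_eq (reinsert x j s) s.
Proof.
move=> s_x; rewrite /reinsert (perm_catCA _ [:: x]) /= cat_take_drop.
by rewrite perm_sym perm_to_rem.
Qed.

Lemma ulam_moves_exist (d : nat) (pi sg : 'S_d) :
  exists n, ulam_moves n pi sg.
Proof.
suff agree m : (m <= d)%N ->
    exists n tau, ulam_moves n pi tau /\ take m (word tau) = take m (word sg).
  have [n [tau [pi_tau eq_tau]]] := agree d (leqnn d).
  exists n; suff <- : tau = sg by [].
  by apply: word_inj; move: eq_tau; rewrite !take_oversize ?size_word.
elim: m => [|m IHm] lt_md; first by exists 0%N, pi; rewrite !take0 /=.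
have [n [tau [pi_tau eq_tau]]] := IHm (ltnW lt_md).
pose j := Ordinal lt_md; pose x := sg j.
have [rho def_rho] := perm_word (perm_reinsert j (mem_word tau x)).
exists (n + 1)%N, rho; split.
  apply: ulam_moves_trans pi_tau _; apply/existsP; exists rho; rewrite /= eqxx.
  by rewrite andbT; apply/existsP; exists x; apply/existsP; exists j; apply/eqP.
have sz_sg : (m < size (word sg))%N by rewrite size_word.
have sz_take : size (take m (word sg)) = m by rewrite size_take sz_sg.
have nth_x : nth x (word sg) m = x by rewrite (nth_word sg x j).
have x_notin : x \notin take m (word sg).
  have : uniq (take m.+1 (word sg)) by rewrite take_uniq ?word_uniq.
  by rewrite (take_nth x sz_sg) nth_x rcons_uniq => /andP[].
have def_rem : rem x (word tau) = take m (word sg) ++ rem x (drop m (word tau)).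
  rewrite -{1}(cat_take_drop m (word tau)) eq_tau.
  elim: (take m (word sg)) x_notin => //= y s IHs.
  by rewrite inE negb_or eq_sym => /andP[/negPf-> /IHs->].
rewrite def_rho /reinsert def_rem (take_size_cat _ sz_take) -cat_rcons.
by rewrite (take_nth x sz_sg) nth_x take_size_cat // size_rcons sz_take.
Qed.

Definition ulam (d : nat) (pi sg : 'S_d) : nat :=
  ex_minn (ulam_moves_exist pi sg).

(** * Fairness *)

(* Groups are allowed to be empty. *)
Definition is_grouping (d g : nat) (G : 'I_g -> {set 'I_d}) : Prop :=
  (forall i j : 'I_g, i != j -> [disjoint G i & G j]) /\
  \bigcup_i G i = [set: 'I_d].

Definition top (d : nat) (pi : 'S_d) (m : nat) : {set 'I_d} :=
  [set pi i | i : 'I_d & (i < m)%N].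

Definition strict_fair (R : archiRealFieldType) (d g : nat)
    (G : 'I_g -> {set 'I_d}) (alpha beta : 'I_g -> R) (k : nat)
    (pi : 'S_d) : Prop :=
  forall m : nat, (k <= m <= d)%N -> forall i : 'I_g,
    Num.floor (alpha i * m%:R) <= #|top pi m :&: G i|%:Z
      <= Num.ceil (beta i * m%:R).

Definition closest_fair (R : archiRealFieldType) (d g : nat)
    (G : 'I_g -> {set 'I_d}) (alpha beta : 'I_g -> R) (k : nat)
    (pi sg : 'S_d) : Prop :=
  strict_fair G alpha beta k sg /\
  forall tau : 'S_d,
    strict_fair G alpha beta k tau -> (ulam pi sg <= ulam pi tau)%N.

(** * Machine model

   Structured programs for a random access machine. The memory consists of
   arrays, indexed by nat, of natural numbers and of elements of R; the name of
   an array is a literal of the program text, so that a program uses finitely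
   many arrays, while the index of a cell is computed at run time.

   The only operations are literals, reading a cell, addition, subtraction
   (truncated on nat) and comparison, each at unit cost. Multiplication,
   division, rounding and conversions between the two sorts are left out:
   t steps then lengthen the binary representation of the stored numbers by
   O(t) bits only (for R = rat, over a common denominator of the inputs), so
   that unit-cost polynomial time is polynomial time on Turing machines. *)

Inductive nexp : Type :=
  | Nlit of nat
  | Nget of nat & nexp
  | Nadd of nexp & nexp
  | Nsub of nexp & nexp.

Inductive rexp : Type :=
  | Rlit of nat
  | Rget of nat & nexp
  | Radd of rexp & rexp
  | Rsub of rexp & rexp.

Inductive bexp : Type :=
  | Nle of nexp & nexp
  | Rle of rexp & rexp
  | Bnot of bexp.

(* [Nset x e e'] and [Rset x e e'] write e' to cell e of array x. *)
Inductive cmd : Type :=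
  | Skip
  | Nset of nat & nexp & nexp
  | Rset of nat & nexp & rexp
  | Seq of cmd & cmd
  | If of bexp & cmd & cmd
  | While of bexp & cmd.

Fixpoint ncost (e : nexp) : nat :=
  match e with
  | Nlit _ => 1
  | Nget _ e1 => (ncost e1).+1
  | Nadd e1 e2 | Nsub e1 e2 => (ncost e1 + ncost e2).+1
  end.

Fixpoint rcost (e : rexp) : nat :=
  match e with
  | Rlit _ => 1
  | Rget _ e1 => (ncost e1).+1
  | Radd e1 e2 | Rsub e1 e2 => (rcost e1 + rcost e2).+1
  end.

Fixpoint bcost (b : bexp) : nat :=
  match b with
  | Nle e1 e2 => (ncost e1 + ncost e2).+1
  | Rle e1 e2 => (rcost e1 + rcost e2).+1
  | Bnot b1 => (bcost b1).+1
  end.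

Record store (R : Type) : Type := Store {
  nmem : nat -> nat -> nat;
  rmem : nat -> nat -> R
}.

Definition upd (T : Type) (M : nat -> nat -> T) (x i : nat) (v : T)
    : nat -> nat -> T :=
  fun y j => if (y == x) && (j == i) then v else M y j.

Fixpoint neval (R : Type) (s : store R) (e : nexp) : nat :=
  match e with
  | Nlit n => n
  | Nget x e1 => nmem s x (neval s e1)
  | Nadd e1 e2 => (neval s e1 + neval s e2)%N
  | Nsub e1 e2 => (neval s e1 - neval s e2)%N
  end.

Fixpoint reval (R : archiRealFieldType) (s : store R) (e : rexp) : R :=
  match e with
  | Rlit n => n%:R
  | Rget x e1 => rmem s x (neval s e1)
  | Radd e1 e2 => reval s e1 + reval s e2
  | Rsub e1 e2 => reval s e1 - reval s e2
  end.

Fixpoint beval (R : archiRealFieldType) (s : store R) (b : bexp) : bool :=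
  match b with
  | Nle e1 e2 => (neval s e1 <= neval s e2)%N
  | Rle e1 e2 => reval s e1 <= reval s e2
  | Bnot b1 => ~~ beval s b1
  end.

(* [exec c s t s']: started in s, the program c halts in s' after t steps. *)
Inductive exec (R : archiRealFieldType) :
    cmd -> store R -> nat -> store R -> Prop :=
  | exec_skip s : exec Skip s 1 s
  | exec_nset s x e1 e2 :
      exec (Nset x e1 e2) s (ncost e1 + ncost e2).+1
        (Store (upd (nmem s) x (neval s e1) (neval s e2)) (rmem s))
  | exec_rset s x e1 e2 :
      exec (Rset x e1 e2) s (ncost e1 + rcost e2).+1
        (Store (nmem s) (upd (rmem s) x (neval s e1) (reval s e2)))
  | exec_seq c1 c2 s1 t1 s2 t2 s3 :
      exec c1 s1 t1 s2 -> exec c2 s2 t2 s3 ->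
      exec (Seq c1 c2) s1 (t1 + t2) s3
  | exec_if b c1 c2 s t s' :
      exec (if beval s b then c1 else c2) s t s' ->
      exec (If b c1 c2) s (bcost b + t).+1 s'
  | exec_while_stop b c s :
      ~~ beval s b -> exec (While b c) s (bcost b).+1 s
  | exec_while_step b c s1 t1 s2 t2 s3 :
      beval s1 b -> exec c s1 t1 s2 -> exec (While b c) s2 t2 s3 ->
      exec (While b c) s1 (bcost b + t1 + t2).+1 s3.

(** * Input and output conventions *)

Definition cells (T : Type) (z : T) (n : nat) (f : 'I_n -> T) (j : nat) : T :=
  oapp f z (insub j).

(* nat array 0 holds d and k, nat array 1 the ranking, nat array 2 the label
   of the group of each candidate; R arrays 0 and 1 hold alpha and beta.
   All other cells are 0. *)
Definition input (R : archiRealFieldType) (d g : nat) (pi : 'S_d)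
    (G : 'I_g -> {set 'I_d}) (alpha beta : 'I_g -> R) (k : nat) : store R :=
  Store
    (fun x => match x with
      | 0 => nth 0%N [:: d; k]
      | 1 => cells 0%N (fun i : 'I_d => pi i : nat)
      | 2 => cells 0%N
               (fun a : 'I_d => oapp (@nat_of_ord g) 0%N [pick i | a \in G i])
      | _ => fun=> 0%N
      end)
    (fun x => match x with
      | 0 => cells 0 alpha
      | 1 => cells 0 beta
      | _ => fun=> 0
      end).

Definition output_is (R : Type) (d : nat) (s : store R) (sg : 'S_d) : Prop :=
  forall i : 'I_d, nmem s 3 i = sg i.

(* Main.v *)
Require Import Defs.
From mathcomp Require Import all_boot all_order all_algebra all_fingroup.
From mathcomp Require Import zify.

(* The elements of pi outside a common subsequence of pi and a fair ranking may
   be permuted freely within their groups, and d minus the length of a longest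
   common subsequence is the Ulam distance. So it is enough to choose the
   sequence of groups of the output together with an order-preserving partial
   matching of its ranks with the candidates of pi, group by group. Such a
   matching is a path whose steps drop a candidate of pi, keep it at the next
   rank, or insert a candidate of some group at the next rank; the distance is
   the number of insertions. Fairness of a prefix only depends on the number of
   candidates of each group in it, hence there are (d+1)^(g+3) states. The
   program numbers them in base d+1, marks the reachable ones in increasing
   order, finds the final state with the fewest insertions, follows the path
   back, and gives the inserted ranks of each group to its dropped candidates. *)

Set Implicit Arguments.
Unset Strict Implicit.
Unset Printing Implicit Defensive.

Import Order.TTheory GRing.Theory Num.Theory.

(** * Ulam distance and common subsequences *)

Section Ulam.
Local Open Scope nat_scope.

Lemma ulam_moves_common (d n : nat) (pi sg : 'S_d) : ulam_moves n pi sg ->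
  exists A : seq 'I_d, [/\ subseq A (word pi),
    subseq A (word sg) & d <= size A + n].
Proof.
elim: n pi => [|n IHn] pi /=.
  by move/eqP->; exists (word sg); rewrite size_word addn0.
case/existsP=> tau /andP[/existsP[x /existsP[j /eqP tauE]]
  /IHn[A [Atau Asg sA]]].
have uA : uniq A by apply: subseq_uniq Atau (word_uniq _).
exists (rem x A); split.
- rewrite (rem_filter _ uA).
  apply: (@subseq_trans _ (filter (predC1 x) (word tau))).
    by rewrite subseq_filter filter_all (subseq_trans (filter_subseq _ _)).
  rewrite tauE /reinsert filter_cat /= eqxx -filter_cat cat_take_drop.
  by apply: subseq_trans (filter_subseq _ _) (rem_subseq _ _).
- exact: subseq_trans (rem_subseq _ _) Asg.
apply: leq_trans sA _; rewrite addnS -addSn leq_add2r.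
by have [/size_rem ->|/rem_id ->] := boolP (x \in A); rewrite ?leqSpred.
Qed.

Lemma ulam_common (d : nat) (pi sg : 'S_d) :
  exists A : seq 'I_d, [/\ subseq A (word pi),
    subseq A (word sg) & d <= size A + ulam pi sg].
Proof. by apply: ulam_moves_common; rewrite /ulam; case: ex_minnP. Qed.

Lemma subseq_catP (T : eqType) (s1 s2 s : seq T) : subseq (s1 ++ s2) s ->
  exists t1 t2, [/\ s = t1 ++ t2, subseq s1 t1 & subseq s2 t2].
Proof.
elim: s s1 => [|y s IHs] [|x s1] /=.
- by move/eqP->; exists [::], [::].
- by [].
- by move=> sub; exists [::], (y :: s).
case: eqP => [<- /IHs|_ /(IHs (x :: s1))] [t1 [t2 [-> sub1 sub2]]].
  by exists (x :: t1), t2; rewrite /= eqxx.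
exists (y :: t1), t2; split=> //=; case: eqP => // _.
by apply: subseq_trans (subseq_cons _ _) sub1.
Qed.

Lemma ulam_moves_of_common (d n : nat) (pi sg : 'S_d) (A : seq 'I_d) :
    subseq A (word pi) -> subseq A (word sg) -> size A + n = d ->
  ulam_moves n pi sg.
Proof.
elim: n pi A => [|n IHn] pi A Api Asg; rewrite (addn0, addnS) => sA.
  have full tau : subseq A (word tau) -> A = word tau.
    by case/size_subseq_leqif=> _; rewrite sA size_word eqxx => /esym/eqP.
  by apply/eqP/word_inj; rewrite -(full pi) // -(full sg).
have uA : uniq A by apply: subseq_uniq Asg (word_uniq _).
have [x xA] : exists x, x \notin A.
  apply/existsP; rewrite -negb_forall; apply/forallP => Ax.
  have /(uniq_leq_size (enum_uniq 'I_d)) : {subset enum 'I_d <= A} by [].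
  by rewrite size_enum_ord leqNgt -[X in _ < X]sA ltnS leq_addr.
have AE : A = filter (mem A) (word sg) by apply/subseq_uniqP=> //; apply:
  word_uniq.
pose A' := filter [in x :: A] (word sg).
have A'sg : subseq A' (word sg) by apply: filter_subseq.
have [A1 [A2 [defA defA']]] : exists A1 A2, A = A1 ++ A2 /\ A' = A1 ++ x :: A2.
  have := word_uniq sg; have := mem_word sg x; rewrite /A' {1}AE.
  case/splitPr=> s1 s2; rewrite cat_uniq /= => /and3P[_ /norP[xs1 _]
    /andP[xs2 _]].
  exists (filter (mem A) s1), (filter (mem A) s2).
  rewrite !filter_cat /= inE eqxx (negPf xA) /=; split=> //.
  congr (_ ++ x :: _); apply: eq_in_filter => y ys; rewrite inE /=.
    by case: eqP => // yx; case/negP: xs1; rewrite -yx.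
  by case: eqP => // yx; case/negP: xs2; rewrite -yx.
have Arem : subseq A (rem x (word pi)).
  rewrite rem_filter ?word_uniq // subseq_filter Api andbT.
  by apply/allP=> y yA /=; apply: contraNneq xA => <-.
rewrite defA in Arem; have [s1 [s2 [rE sub1 sub2]]] := subseq_catP Arem.
have [tau tauE] := perm_word (perm_reinsert (size s1) (mem_word pi x)).
have s1_lt : size s1 < d.
  have szr : size s1 + size s2 = d.-1.
    by rewrite -size_cat -rE size_rem ?mem_word // size_word.
  have d_gt0 : 0 < d by apply: leq_ltn_trans (ltn_ord x).
  by rewrite (leq_ltn_trans (leq_addr (size s2) _)) ?szr ?ltn_predL.
apply/existsP; exists tau; apply/andP; split.
  apply/existsP; exists x; apply/existsP; exists (Ordinal s1_lt).
  by rewrite tauE.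
apply: (IHn _ A'); rewrite ?defA' //.
- rewrite tauE /reinsert rE take_size_cat // drop_size_cat //.
  by rewrite cat_subseq //= eqxx.
- by rewrite -defA'.
by move: sA; rewrite defA !size_cat /=; lia.
Qed.

Lemma ulam_le_common (d : nat) (pi sg : 'S_d) (A : seq 'I_d) :
  subseq A (word pi) -> subseq A (word sg) -> ulam pi sg <= d - size A.
Proof.
move=> Api Asg; rewrite /ulam; case: ex_minnP => m _; apply.
apply: (ulam_moves_of_common Api Asg); rewrite subnKC //.
by have := size_subseq Api; rewrite size_word.
Qed.

End Ulam.

(** * Paths and the rankings they describe *)

Inductive step : Type := Drop of nat | Ins of nat | Keep of nat.

Definition color (e : step) : nat := let: (Drop i | Ins i | Keep i) := e in i.
Definition reads (e : step) : bool := if e is Ins _ then false else true.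
Definition writes (e : step) : bool := if e is Drop _ then false else true.

(* The registers of a state: 0 counts the candidates read from the input
   ranking, 1 the inserted ones, 2 the ranks filled, and i.+3 the ranks filled
   with group i. *)
Definition incr (e : step) (r : nat) : bool :=
  match r with
  | 0 => reads e
  | 1 => ~~ reads e
  | 2 => writes e
  | i.+3 => writes e && (color e == i)
  end.

(* Sequences of steps are kept in reverse: the last step comes first. *)
Definition vec (rs : seq step) (r : nat) : nat := count (incr^~ r) rs.

Lemma vec_cons (e : step) (rs : seq step) (r : nat) :
  vec (e :: rs) r = (incr e r + vec rs r)%N.
Proof. by []. Qed.

Arguments vec : simpl never.

Section Paths.
Local Open Scope nat_scope.

Lemma iota0_rcons n : iota 0 n.+1 = rcons (iota 0 n) n.
Proof. by rewrite -addn1 iotaD cats1. Qed.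

Lemma iota0_vec e rs r : iota 0 (vec (e :: rs) r) =
  if incr e r then rcons (iota 0 (vec rs r)) (vec rs r) else iota 0 (vec rs r).
Proof. by rewrite vec_cons; case: incr; rewrite // add1n iota0_rcons. Qed.

Lemma digits_lt (B n : nat) (v : nat -> nat) : (forall r, r < n -> v r < B) ->
  \sum_(r < n) v r * B ^ r < B ^ n.
Proof.
elim: n => [|n IHn] v_lt; first by rewrite big_ord0.
rewrite big_ord_recr /= expnS.
have := IHn (fun r lt_r => v_lt r (ltnW lt_r)); have := v_lt n (ltnSn n).
move: (B ^ n) (\sum_(r < n) _) (v n) => P S x; nia.
Qed.

Lemma digits_inj (B n : nat) (v v' : nat -> nat) :
    (forall r, r < n -> v r < B) -> (forall r, r < n -> v' r < B) ->
    \sum_(r < n) v r * B ^ r = \sum_(r < n) v' r * B ^ r ->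
  forall r, r < n -> v r = v' r.
Proof.
elim: n => [//|n IHn] v_lt v'_lt; rewrite !big_ord_recr /= => eq_vv'.
have vl r : r < n -> v r < B by move/ltnW/v_lt.
have v'l r : r < n -> v' r < B by move/ltnW/v'_lt.
have lt_s := digits_lt vl; have lt_s' := digits_lt v'l.
have eq_n : v n = v' n.
  move: lt_s lt_s' eq_vv'; move: (B ^ n) (\sum_(r < n) v r * _).
  by move: (\sum_(r < n) _) (v n) (v' n) => S' x x' P S; nia.
move=> r; rewrite ltnS leq_eqVlt => /orP[/eqP->//|]; apply: IHn => //.
by move: eq_vv'; rewrite eq_n => /addIn.
Qed.

Variables (g d : nat) (p lab : nat -> nat) (fairv : (nat -> nat) -> bool).
Hypothesis fairv_ext : forall v v' : nat -> nat,
  (forall r, r < g.+3 -> v r = v' r) -> fairv v = fairv v'.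

Definition enabled (e : step) (v : nat -> nat) : bool :=
  [&& color e < g, reads e ==> (v 0 < d) && (lab (p (v 0)) == color e),
      writes e ==> (v 2 < d) & fairv v].

Fixpoint valid (rs : seq step) : bool :=
  if rs is e :: rs' then enabled e (vec rs') && valid rs' else true.

Definition code (v : nat -> nat) : nat := \sum_(r < g.+3) v r * d.+1 ^ r.

Definition delta (e : step) : nat :=
  (if reads e then 1 else d.+1)
  + (if writes e then d.+1 ^ 2 + d.+1 ^ (color e).+3 else 0).

Lemma enabled_ext e v v' : (forall r, r < g.+3 -> v r = v' r) ->
  enabled e v = enabled e v'.
Proof. by move=> eq_v; rewrite /enabled !eq_v // (fairv_ext eq_v). Qed.

Lemma vec1_le rs : vec rs 1 <= vec rs 2.
Proof. by apply: sub_count; case. Qed.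

Lemma vecc_le rs i : vec rs i.+3 <= vec rs 2.
Proof. by apply: sub_count => e /= /andP[]. Qed.

Lemma valid_le rs r : valid rs -> vec rs r <= d.
Proof.
move=> v_rs; have [le0 le2] : vec rs 0 <= d /\ vec rs 2 <= d.
  elim: rs v_rs => //= e rs IHrs /andP[/and4P[_ r_e w_e _] /IHrs[le0 le2]].
  by rewrite !vec_cons; case: e r_e w_e => i /=; lia.
case: r => [//|[|[//|i]]].
  by apply: leq_trans (vec1_le _) le2.
by apply: leq_trans (vecc_le _ _) le2.
Qed.

Lemma code_inj v v' : (forall r, r < g.+3 -> v r <= d) ->
    (forall r, r < g.+3 -> v' r <= d) -> code v = code v' ->
  forall r, r < g.+3 -> v r = v' r.
Proof. by move=> le_v le_v'; apply: digits_inj. Qed.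

Lemma code_lt v : (forall r, r < g.+3 -> v r <= d) -> code v < d.+1 ^ g.+3.
Proof. by move=> le_v; apply: digits_lt. Qed.

Lemma code_nil : code (vec [::]) = 0.
Proof. by apply: big1. Qed.

Lemma eq_code v v' : (forall r, r < g.+3 -> v r = v' r) -> code v = code v'.
Proof. by move=> eq_v; apply: eq_bigr => r _; rewrite eq_v. Qed.

Lemma code_cons e rs : color e < g ->
  code (vec (e :: rs)) = code (vec rs) + delta e.
Proof.
move=> e_lt; rewrite addnC /code.
under eq_bigr => r _ do rewrite vec_cons mulnDl.
rewrite big_split /=; congr (_ + _).
suff {rs} sumE (P : nat -> nat) : \sum_(r < g.+3) incr e r * P r
    = (if reads e then P 0 else P 1)
      + (if writes e then P 2 + P (color e).+3 else 0).
  exact: (sumE (expn d.+1)).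
have pick i : i < g -> \sum_(r < g) (i == r) * P r.+3 = P i.+3.
  move=> i_lt; rewrite (bigD1 (Ordinal i_lt)) //= eqxx big1 ?mul1n ?addn0 //.
  move=> r /eqP r_i; case: eqP => // ir.
  by case: r_i; apply: val_inj; rewrite /= -ir.
rewrite !big_ord_recl /=; case: e e_lt => i i_lt /=.
- by rewrite big1 /bump; lia.
- by rewrite pick // !mul1n !mul0n.
by rewrite pick // !mul1n !mul0n.
Qed.

Lemma delta_gt0 e : 0 < delta e.
Proof. by case: e. Qed.

Fixpoint kept (rs : seq step) : seq (nat * nat) :=
  if rs is e :: rs' then
    if e is Keep _ then (vec rs' 2, p (vec rs' 0)) :: kept rs' else kept rs'
  else [::].

Fixpoint ins (i : nat) (rs : seq step) : seq nat :=
  if rs is e :: rs' then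
    if e is Ins j then if i == j then vec rs' 2 :: ins i rs' else ins i rs'
    else ins i rs'
  else [::].

Fixpoint drp (i : nat) (rs : seq step) : seq nat :=
  if rs is e :: rs' then
    if e is Drop j then if i == j then p (vec rs' 0) :: drp i rs' else drp i rs'
    else drp i rs'
  else [::].

Fixpoint cols (rs : seq step) : seq nat :=
  if rs is e :: rs' then
    if writes e then rcons (cols rs') (color e) else cols rs'
  else [::].

Lemma size_cols rs : size (cols rs) = vec rs 2.
Proof. by elim: rs => //= -[] i rs IHrs /=; rewrite ?size_rcons IHrs. Qed.

Lemma count_cols rs i : count_mem i (cols rs) = vec rs i.+3.
Proof.
elim: rs => //= e rs IHrs; rewrite !vec_cons /= -IHrs.
by case: (writes e); rewrite // -cats1 count_cat /= addn0 addnC.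
Qed.

Lemma perm_cat_consr (T : eqType) (x : T) (s t t' : seq T) :
  perm_eq t (x :: t') -> perm_eq (s ++ t) (x :: s ++ t').
Proof.
move=> tt'; apply: (@perm_trans _ (s ++ [:: x] ++ t'));
  first by rewrite perm_cat2l.
by rewrite perm_catCA.
Qed.

Lemma perm_flatten_upd (s : seq nat) (j x : nat) (f : nat -> seq nat) :
    uniq s -> j \in s ->
  perm_eq (flatten [seq (if i == j then x :: f i else f i) | i <- s])
          (x :: flatten [seq f i | i <- s]).
Proof.
elim: s => //= y s IHs /andP[ys us]; rewrite inE.
have [-> _|jy /= js] := eqVneq j y.
  rewrite /= perm_cons perm_cat2l; set t := map _ s; suff -> :
    t = map f s by [].
  by apply/eq_in_map => i is_; case: eqP => // iy; case/negP: ys; rewrite -iy.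
by apply: perm_cat_consr; apply: IHs.
Qed.

Definition all_ins rs := flatten [seq ins i rs | i <- iota 0 g].
Definition all_drp rs := flatten [seq drp i rs | i <- iota 0 g].

Lemma perm_positions rs : valid rs ->
  perm_eq (unzip1 (kept rs) ++ all_ins rs) (iota 0 (vec rs 2)).
Proof.
rewrite /all_ins; elim: rs => [_|e rs IHrs]; first by elim: (iota 0 g).
case/andP=> /and4P[e_lt _ _ _] /IHrs{}IHrs.
rewrite iota0_vec; case: e e_lt => i i_lt /=.
- exact: IHrs.
- rewrite perm_sym perm_rcons perm_sym.
  apply: (@perm_trans _ (vec rs 2 :: unzip1 (kept rs) ++ all_ins rs));
    last first.
    by rewrite perm_cons.
  by apply: perm_cat_consr; apply: perm_flatten_upd;
    rewrite ?iota_uniq ?mem_iota.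
by rewrite perm_sym perm_rcons perm_sym perm_cons.
Qed.

Lemma perm_candidates rs : valid rs ->
  perm_eq (unzip2 (kept rs) ++ all_drp rs) (map p (iota 0 (vec rs 0))).
Proof.
rewrite /all_drp; elim: rs => [_|e rs IHrs]; first by elim: (iota 0 g).
case/andP=> /and4P[e_lt _ _ _] /IHrs{}IHrs.
rewrite iota0_vec; case: e e_lt => i i_lt /=.
- rewrite map_rcons perm_sym perm_rcons perm_sym.
  apply: (@perm_trans _ (p (vec rs 0) :: unzip2 (kept rs) ++ all_drp rs));
    last first.
    by rewrite perm_cons.
  by apply: perm_cat_consr; apply: perm_flatten_upd;
    rewrite ?iota_uniq ?mem_iota.
- exact: IHrs.
by rewrite map_rcons perm_sym perm_rcons perm_sym perm_cons.
Qed.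

Lemma size_ins_drp rs i : valid rs ->
  size (ins i rs) + count (fun a => lab a == i) (map p (iota 0 (vec rs 0)))
  = size (drp i rs) + vec rs i.+3.
Proof.
elim: rs => //= e rs IHrs /andP[/and4P[_ r_e _ _] /IHrs{}IHrs].
rewrite iota0_vec vec_cons; case: e r_e => j /=.
- case/andP=> _ /eqP lab_j; rewrite map_rcons.
  by rewrite -cats1 count_cat /= lab_j (eq_sym j i); case: eqP => /= _; lia.
- by move=> _; rewrite (eq_sym j i); case: eqP => /= _; lia.
case/andP=> _ /eqP lab_j; rewrite map_rcons.
by rewrite -cats1 count_cat /= lab_j (eq_sym j i); case: eqP => /= _; lia.
Qed.

Lemma ins_cols rs i x : x \in ins i rs -> x < vec rs 2 /\ nth 0 (cols rs) x = i.
Proof.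
elim: rs => //= e rs IHrs; case: e => j /=.
- exact: IHrs.
- rewrite !vec_cons /= nth_rcons size_cols.
  case: eqP => [<-|_]; rewrite ?inE.
    case/predU1P => [->|/IHrs[lt_x <-]]; first by rewrite ltnn eqxx.
    by rewrite lt_x ltnS ltnW.
  by case/IHrs=> lt_x <-; rewrite lt_x ltnS ltnW.
rewrite !vec_cons /= nth_rcons size_cols.
by case/IHrs=> lt_x <-; rewrite lt_x ltnS ltnW.
Qed.

Lemma drp_lab rs i x : valid rs -> x \in drp i rs -> lab x = i.
Proof.
elim: rs => //= e rs IHrs /andP[/and4P[_ r_e _ _] v_rs].
case: e r_e => j //=; try by move=> *; apply: IHrs.
case/andP=> _ /eqP lab_j; case: eqP => [ij|_]; last exact: IHrs.
by rewrite inE => /predU1P[->|]; [rewrite lab_j | apply: IHrs].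
Qed.

Lemma kept_cols rs xa : valid rs -> xa \in kept rs ->
  xa.1 < vec rs 2 /\ lab xa.2 = nth 0 (cols rs) xa.1.
Proof.
elim: rs => //= e rs IHrs /andP[/and4P[_ r_e _ _] v_rs].
case: e r_e => j /=.
- by move=> _ /(IHrs v_rs).
- move=> _ /(IHrs v_rs)[lt_x ->]; rewrite !vec_cons /= nth_rcons size_cols.
  by rewrite lt_x ltnS ltnW.
case/andP=> _ /eqP lab_j; rewrite !vec_cons /= nth_rcons size_cols inE.
case/predU1P => [->|/(IHrs v_rs)[lt_x ->]] /=; first by rewrite ltnn eqxx.
by rewrite lt_x ltnS ltnW.
Qed.

Lemma kept_subseq rs :
  subseq (rev (unzip1 (kept rs))) (iota 0 (vec rs 2)) /\
  subseq (rev (unzip2 (kept rs))) (map p (iota 0 (vec rs 0))).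
Proof.
elim: rs => //= e rs [IH1 IH2]; rewrite !iota0_vec; case: e => j /=.
- by split=> //; rewrite map_rcons; apply: subseq_trans (subseq_rcons _ _).
- by split=> //; apply: subseq_trans (subseq_rcons _ _).
by rewrite map_rcons !rev_cons -!cats1 !cat_subseq ?eqxx.
Qed.

Lemma size_kept rs : size (kept rs) + vec rs 1 = vec rs 2.
Proof. by elim: rs => //= -[] j rs IHrs; rewrite !vec_cons /=; lia. Qed.

Lemma cols_prefix rs m : valid rs -> m < vec rs 2 -> exists rs',
  [/\ fairv (vec rs'), vec rs' 2 = m & cols rs' = take m (cols rs)].
Proof.
elim: rs => //= e rs IHrs /andP[/and4P[_ _ _ f_rs] v_rs].
rewrite !vec_cons /=; case: (writes e); last exact: IHrs.
rewrite add1n ltnS leq_eqVlt -cats1 => /predU1P[->|lt_m].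
  by exists rs; rewrite take_cat size_cols ltnn subnn cats0.
have [rs' [f_rs' m_rs' c_rs']] := IHrs v_rs lt_m.
by exists rs'; rewrite take_cat size_cols lt_m.
Qed.

Definition assignment rs : seq (nat * nat) :=
  kept rs ++ flatten [seq zip (ins i rs) (drp i rs) | i <- iota 0 g].

Section Complete.
Variable rs : seq step.
Hypotheses (v_rs : valid rs) (rs0 : vec rs 0 = d) (rs2 : vec rs 2 = d).
Hypothesis rsc : forall i, i < g ->
  vec rs i.+3 = count (fun a => lab a == i) (map p (iota 0 d)).

Lemma size_ins i : i < g -> size (ins i rs) = size (drp i rs).
Proof. by move/rsc=> e; have := size_ins_drp i v_rs; rewrite rs0 e =>
  /addIn. Qed.

Lemma assignment_positions : perm_eq (unzip1 (assignment rs)) (iota 0 d).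
Proof.
rewrite -rs2; apply: perm_trans (perm_positions v_rs).
rewrite /unzip1 map_cat perm_cat2l map_flatten -map_comp /all_ins.
set t := map _ _; suff -> : t = [seq ins i rs | i <- iota 0 g] by [].
apply/eq_in_map => i; rewrite /= mem_iota => /andP[_ lt_i].
by apply: unzip1_zip; rewrite size_ins.
Qed.

Lemma assignment_candidates :
  perm_eq (unzip2 (assignment rs)) (map p (iota 0 d)).
Proof.
rewrite -rs0; apply: perm_trans (perm_candidates v_rs).
rewrite /unzip2 map_cat perm_cat2l map_flatten -map_comp /all_drp.
set t := map _ _; suff -> : t = [seq drp i rs | i <- iota 0 g] by [].
apply/eq_in_map => i; rewrite /= mem_iota => /andP[_ lt_i].
by apply: unzip2_zip; rewrite size_ins.
Qed.

Lemma assignment_cols xa : xa \in assignment rs ->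
  lab xa.2 = nth 0 (cols rs) xa.1.
Proof.
rewrite mem_cat => /orP[/(kept_cols v_rs)[]//|/flattenP[s /mapP[i _ ->]]].
case: xa => x a xa_s; have [/ins_cols[_ ->] /(drp_lab v_rs)->//] :
  x \in ins i rs /\ a \in drp i rs.
elim: (ins i rs) (drp i rs) xa_s => [|y s1 IHs] [|b s2] //=.
rewrite !inE xpair_eqE => /orP[/andP[-> ->] //|/IHs[-> ->]].
by rewrite !orbT.
Qed.

End Complete.


Section Alignment.
Variable q : nat -> nat.
Hypotheses (lab_p : forall j, j < d -> lab (p j) < g)
  (lab_q : forall m, m < d -> lab (q m) < g).

Definition follows (v : nat -> nat) : Prop :=
  forall i, i < g -> v i.+3 = count (fun a =>
    lab a == i) (map q (iota 0 (v 2))).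

Hypothesis fair_q : forall v, v 2 <= d -> follows v -> fairv v.

Lemma follows_cons e rs :
    (writes e -> color e = lab (q (vec rs 2))) -> follows (vec rs) ->
  follows (vec (e :: rs)).
Proof.
move=> col_e fol_rs i lt_i; rewrite iota0_vec vec_cons fol_rs //=.
case: (writes e) col_e => //= ->; rewrite // map_rcons -cats1 count_cat /=.
by rewrite addn0 addnC.
Qed.

Lemma align A rs : valid rs -> vec rs 0 <= d -> vec rs 2 <= d ->
    follows (vec rs) ->
    subseq A (map p (iota (vec rs 0) (d - vec rs 0))) ->
    subseq A (map q (iota (vec rs 2) (d - vec rs 2))) ->
  exists rs', [/\ valid rs', vec rs' 0 = d, vec rs' 2 = d, follows (vec rs') &
    vec rs' 1 + size A + vec rs 2 <= vec rs 1 + d].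
Proof.
have [n] := ubnP (d - vec rs 0 + (d - vec rs 2)).
elim: n A rs => // n IHn A rs le_n v_rs le0 le2 fol subp subq.
have f_rs : fairv (vec rs) by apply: fair_q.
have iota_lt a : a < d -> iota a (d - a) = a :: iota a.+1 (d - a.+1).
  by move=> lt_a; rewrite -[in LHS](subnSK lt_a).
have insert : vec rs 2 < d ->
    subseq A (map q (iota (vec rs 2).+1 (d - (vec rs 2).+1))) ->
    exists rs', [/\ valid rs', vec rs' 0 = d, vec rs' 2 = d, follows (vec rs') &
      vec rs' 1 + size A + vec rs 2 <= vec rs 1 + d].
  move=> lt2 subq'; pose e := Ins (lab (q (vec rs 2))).
  have [|||||||rs'] := IHn A (e :: rs); rewrite ?vec_cons //=; try lia.
  - by rewrite /enabled /= lab_q // lt2 f_rs.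
  - exact: follows_cons.
  by case=> *; exists rs'; split=> //; lia.
have [lt0|ge0] := ltnP (vec rs 0) d; last first.
  have /eqP eq0 : vec rs 0 == d by rewrite eqn_leq le0.
  move: subp; rewrite eq0 subnn => /eqP A0; subst A.
  have [lt2|ge2] := ltnP (vec rs 2) d; last by exists rs; split=> //=; lia.
  by apply: insert; rewrite ?sub0seq.
have [sub'|nsub'] :=
    boolP (subseq A (map p (iota (vec rs 0).+1 (d - (vec rs 0).+1)))).
  pose e := Drop (lab (p (vec rs 0))).
  have [|||||||rs'] := IHn A (e :: rs); rewrite ?vec_cons //=; try lia.
    by rewrite /enabled /= lab_p // lt0 f_rs eqxx.
  by case=> *; exists rs'; split=> //; lia.
rewrite iota_lt //= in subp; case: A subp subq nsub' insert => /= [_ _|a A].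
  by rewrite sub0seq.
case: eqP => [-> subp subq _ insert|_ -> //].
have [lt2|ge2] := ltnP (vec rs 2) d; last first.
  by move: subq; rewrite (eqP ge2).
rewrite iota_lt //= in subq; move: subq; case: eqP => [pq subq|_]; last exact:
  insert.
pose e := Keep (lab (p (vec rs 0))).
have [|||||||rs'] := IHn A (e :: rs); rewrite ?vec_cons //=; try lia.
- by rewrite /enabled /= lab_p // lt0 f_rs eqxx lt2.
- by apply: follows_cons => // _; rewrite /= pq.
by case=> *; exists rs'; split=> //; lia.
Qed.

Lemma valid_of_common A :
    subseq A (map p (iota 0 d)) -> subseq A (map q (iota 0 d)) ->
  exists rs, [/\ valid rs, vec rs 0 = d, vec rs 2 = d, follows (vec rs) &
    vec rs 1 + size A <= d].
Proof.
move=> subp subq; have [||||||rs] := @align A [::]; rewrite ?subn0 //.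
by rewrite addn0 add0n; exists rs.
Qed.

End Alignment.

End Paths.

(** * Reasoning about programs *)

(* A bound on the running time of a program in which every loop makes at most
   n iterations each time it is entered. *)
Fixpoint time (n : nat) (c : cmd) : nat :=
  match c with
  | Skip => 1
  | Nset _ e1 e2 => (ncost e1 + ncost e2).+1
  | Rset _ e1 e2 => (ncost e1 + rcost e2).+1
  | Seq c1 c2 => time n c1 + time n c2
  | If b c1 c2 => (bcost b).+1 + (time n c1 + time n c2)
  | While b c1 => (bcost b).+1 + n * ((bcost b).+1 + time n c1)
  end.

Fixpoint time_poly (c : cmd) : {poly nat} :=
  match c with
  | Skip => 1
  | Nset _ e1 e2 => ((ncost e1 + ncost e2).+1)%:P
  | Rset _ e1 e2 => ((ncost e1 + rcost e2).+1)%:P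
  | Seq c1 c2 => time_poly c1 + time_poly c2
  | If b c1 c2 => ((bcost b).+1)%:P + (time_poly c1 + time_poly c2)
  | While b c1 => ((bcost b).+1)%:P + 'X * (((bcost b).+1)%:P + time_poly c1)
  end%R.

Lemma time_polyE (c : cmd) (n : nat) : (time_poly c).[n]%R = time n c.
Proof.
by elim: c => [|x e1 e2|x e1 e2|c1 IH1 c2 IH2|b c1 IH1 c2 IH2|b c IHc] /=;
  rewrite !(hornerD, hornerM, hornerC, hornerX) ?IH1 ?IH2 ?IHc.
Qed.

Fixpoint nwrites (c : cmd) (y : nat) : bool :=
  match c with
  | Nset x _ _ => y == x
  | Seq c1 c2 | If _ c1 c2 => nwrites c1 y || nwrites c2 y
  | While _ c1 => nwrites c1 y
  | _ => false
  end.

Fixpoint rwrites (c : cmd) (y : nat) : bool :=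
  match c with
  | Rset x _ _ => y == x
  | Seq c1 c2 | If _ c1 c2 => rwrites c1 y || rwrites c2 y
  | While _ c1 => rwrites c1 y
  | _ => false
  end.

Definition scalar (x : nat) : nexp := Nget x (Nlit 0).
Definition assign (x : nat) (e : nexp) : cmd := Nset x (Nlit 0) e.

Definition For (x : nat) (e : nexp) (c : cmd) : cmd :=
  Seq (assign x (Nlit 0))
    (While (Bnot (Nle e (scalar x)))
      (Seq c (assign x (Nadd (scalar x) (Nlit 1))))).

Fixpoint foreach (m : nat) (f : nat -> cmd) : cmd :=
  if m is m'.+1 then Seq (foreach m' f) (f m') else Skip.

Lemma nwrites_foreach (m : nat) (f : nat -> cmd) (y : nat) :
  (forall i, ~~ nwrites (f i) y) -> ~~ nwrites (foreach m f) y.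
Proof. by move=> fy; elim: m => //= m IHm; rewrite negb_or IHm fy. Qed.

Lemma rwrites_foreach (m : nat) (f : nat -> cmd) (y : nat) :
  (forall i, ~~ rwrites (f i) y) -> ~~ rwrites (foreach m f) y.
Proof. by move=> fy; elim: m => //= m IHm; rewrite negb_or IHm fy. Qed.

Definition nset (R : Type) (s : store R) (x i v : nat) : store R :=
  Store (upd (nmem s) x i v) (rmem s).

Definition rset (R : Type) (s : store R) (x i : nat) (v : R) : store R :=
  Store (nmem s) (upd (rmem s) x i v).

Definition keeps (R : Type) (c : cmd) (s s' : store R) : Prop :=
  (forall y, ~~ nwrites c y -> nmem s' y = nmem s y) /\
  (forall y, ~~ rwrites c y -> rmem s' y = rmem s y).

Section Machine.
Local Open Scope nat_scope.
Variables (R : archiRealFieldType) (n : nat).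
Implicit Types (s : store R) (c : cmd).

Definition run c s (Q : store R -> Prop) : Prop :=
  exists t s', [/\ exec c s t s', t <= time n c & Q s'].

Lemma keeps_refl c s : keeps c s s.
Proof. by split. Qed.

Lemma keeps_trans c s1 s2 s3 : keeps c s1 s2 -> keeps c s2 s3 -> keeps c s1 s3.
Proof.
by move=> [k1 l1] [k2 l2]; split=> y cy; [rewrite k2 // k1 | rewrite l2 // l1].
Qed.

Lemma exec_keeps c s t s' : exec c s t s' -> keeps c s s'.
Proof.
elim=> {c s t s'}.
- by move=> s; apply: keeps_refl.
- by move=> s x e1 e2; split=> //= y /negPf yx; rewrite /upd yx.
- by move=> s x e1 e2; split=> //= y /negPf yx; rewrite /upd yx.
- move=> c1 c2 s1 t1 s2 t2 s3 _ [k1 l1] _ [k2 l2].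
  by split=> y /norP[c1y c2y]; [rewrite k2 // k1 | rewrite l2 // l1].
- move=> b c1 c2 s t s' _ [k l].
  by split=> y /norP[c1y c2y]; [rewrite k // | rewrite l //]; case: ifP.
- by move=> b c s _; apply: keeps_refl.
move=> b c s1 t1 s2 t2 s3 _ _ k1 _ k2.
by apply: keeps_trans k2; case: k1.
Qed.

Lemma run_keeps c s Q : run c s Q -> run c s (fun s' => Q s' /\ keeps c s s').
Proof. by case=> t [s' [ex t_le Qs']]; exists t, s'; split=> //; split=> //;
  apply: exec_keeps ex. Qed.

Lemma run_weaken c s (Q Q' : store R -> Prop) :
  run c s Q -> (forall s', Q s' -> Q' s') -> run c s Q'.
Proof. by case=> t [s' [ex t_le Qs']] QQ'; exists t, s'; split=> //; apply:
  QQ'. Qed.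

Lemma run_skip s (Q : store R -> Prop) : Q s -> run Skip s Q.
Proof. by exists 1, s; split=> //; constructor. Qed.

Lemma run_nset x e1 e2 s (Q : store R -> Prop) :
  Q (nset s x (neval s e1) (neval s e2)) -> run (Nset x e1 e2) s Q.
Proof. by move=> Qs; do 2!eexists; split; [constructor | | exact: Qs]. Qed.

Lemma run_rset x e1 e2 s (Q : store R -> Prop) :
  Q (rset s x (neval s e1) (reval s e2)) -> run (Rset x e1 e2) s Q.
Proof. by move=> Qs; do 2!eexists; split; [constructor | | exact: Qs]. Qed.

Lemma run_seq c1 c2 s Q : run c1 s (fun s' => run c2 s' Q) ->
  run (Seq c1 c2) s Q.
Proof.
case=> t1 [s1 [ex1 le1 [t2 [s2 [ex2 le2 Qs2]]]]].
by exists (t1 + t2), s2; split=> //=; [apply: exec_seq ex1 ex2 | apply: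
  leq_add].
Qed.

Lemma run_if b c1 c2 s Q :
    (beval s b -> run c1 s Q) -> (~~ beval s b -> run c2 s Q) ->
  run (If b c1 c2) s Q.
Proof.
move=> run1 run2; have := @exec_if R b c1 c2 s.
case: (boolP (beval s b)) => [/run1|/run2] [t [s' [ex le_t Qs']]]
  /(_ _ _ ex) ex';
  by do 2!eexists; split; [exact: ex' | move=> /= | exact: Qs']; lia.
Qed.

Lemma run_while b c (I : nat -> store R -> Prop) m s Q :
    m <= n -> I m s ->
    (forall m s', beval s' b -> keeps c s s' -> I m s' ->
      exists2 m', m = m'.+1 & run c s' (I m')) ->
    (forall m s', ~~ beval s' b -> keeps c s s' -> I m s' -> Q s') ->
  run (While b c) s Q.
Proof.
move=> le_mn Is step_I end_I.
suff loop s0 : keeps c s s0 -> I m s0 -> exists t s',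
  [/\ exec (While b c) s0 t s',
    t <= (bcost b).+1 + m * ((bcost b).+1 + time n c) & Q s'].
  have [t [s' [ex le_t Qs']]] := loop s (keeps_refl c s) Is.
  exists t, s'; split=> //=; apply: leq_trans le_t _.
  by rewrite leq_add2l leq_mul2r le_mn orbT.
elim: m s0 {le_mn Is} => [|m IHm] s0 k0 I0.
  have [b_s0|nb_s0] := boolP (beval s0 b).
    by have [] := step_I _ _ b_s0 k0 I0.
  exists (bcost b).+1, s0; split; first exact: exec_while_stop.
    by rewrite mul0n addn0.
  exact: end_I I0.
have [b_s0|nb_s0] := boolP (beval s0 b); last first.
  exists (bcost b).+1, s0; split; first exact: exec_while_stop.
    by rewrite leq_addr.
  exact: end_I I0.
have [_ [<-] [t1 [s1 [ex1 le_t1 I1]]]] := step_I _ _ b_s0 k0 I0.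
have [t2 [s2 [ex2 le_t2 Q2]]] := IHm _ (keeps_trans k0 (exec_keeps ex1)) I1.
exists (bcost b + t1 + t2).+1, s2; split=> //; first exact: exec_while_step ex2.
by rewrite mulSn; lia.
Qed.

Lemma run_for x e c (I : nat -> store R -> Prop) N s Q :
    N <= n -> ~~ nwrites c x -> I 0 s ->
    (forall s', keeps (For x e c) s s' -> neval s' e = N) ->
    (forall i v s', I i s' -> I i (nset s' x 0 v)) ->
    (forall i s', i < N -> nmem s' x 0 = i -> keeps (For x e c) s s' -> I i s' ->
      run c s' (I i.+1)) ->
    (forall s', keeps (For x e c) s s' -> I N s' -> Q s') ->
  run (For x e c) s Q.
Proof.
move=> le_Nn cx I0 e_N I_x step_I end_I.
apply/run_seq/run_nset; set s0 := nset _ _ _ _.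
have k0 : keeps (For x e c) s s0.
  by split=> y //=; rewrite negb_or /upd => /andP[/negPf-> _].
have kt s' : keeps (Seq c (assign x (Nadd (scalar x) (Nlit 1)))) s0 s' ->
    keeps (For x e c) s s'.
  move=> [k l]; apply: keeps_trans k0 _; split=> y; last exact: l.
  by case/norP=> _; apply: k.
pose J m s' := exists i, [/\ i + m = N, nmem s' x 0 = i & I i s'].
apply: (@run_while _ _ J N) => //.
- by exists 0; rewrite /= /upd !eqxx; split=> //; apply: I_x.
- move=> m s' /= b_s' /kt k [i [im s'x Ii]].
  have lt_i : i < N by rewrite -s'x -(e_N _ k) ltnNge.
  case: m im => [|m] im; first by lia.
  exists m => //; apply: run_seq.
  apply: run_weaken (run_keeps (step_I _ _ lt_i s'x k Ii)) _ => s1 [I1 [k1 _]].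
  apply: run_nset; exists i.+1; rewrite /= /upd !eqxx (k1 _ cx) s'x addn1.
  by split=> //; [lia | apply: I_x].
move=> m s' /= b_s' /kt k [i [im s'x Ii]]; apply: end_I => //.
by move: b_s'; rewrite negbK (e_N _ k) s'x => ?; suff <- : i = N by []; lia.
Qed.

Lemma run_foreach m f (I : nat -> store R -> Prop) s (Q : store R -> Prop) :
    I 0 s ->
    (forall i s', i < m -> keeps (foreach m f) s s' -> I i s' ->
      run (f i) s' (I i.+1)) ->
    (forall s', keeps (foreach m f) s s' -> I m s' -> Q s') ->
  run (foreach m f) s Q.
Proof.
move=> I0 step_I end_I.
suff run_m : run (foreach m f) s (I m).
  by apply: run_weaken (run_keeps run_m) _ => s' [Is' k]; apply: end_I.
elim: m step_I {end_I} => [_|m IHm step_I] /=; first exact: run_skip.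
apply: run_seq; apply: run_weaken (run_keeps (IHm _)) _ => [i s' lt_i [k l]
  Ii|s' [Im [k l]]].
  by apply: step_I => //; [lia | split=> y /norP[? _]; [apply: k | apply: l]].
by apply: step_I => //; split=> y /norP[? _]; [apply: k | apply: l].
Qed.

End Machine.

(** * The program *)

(* The r-th array of family c; the families c < 32 are pairwise disjoint. *)
Definition arr (c r : nat) : nat := (c + 32 * r)%N.

Lemma arr_eq (c c' r r' : nat) : (c < 32)%N -> (c' < 32)%N ->
  (arr c r == arr c' r') = (c == c') && (r == r').
Proof. by rewrite /arr; lia. Qed.

Local Notation a_out := 3.
Local Notation a_idx := 4.
Local Notation a_pow := 5.
Local Notation a_seen := 6.
Local Notation a_pred := 7.
Local Notation a_tag := 8.
Local Notation a_reg := (arr 19).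
Local Notation a_drp := (arr 20).
Local Notation a_ins := (arr 21).
Local Notation a_ndrp := 12.
Local Notation a_nins := 13.
Local Notation a_cur := 14.
Local Notation a_fair := 15.
Local Notation a_new := 16.
Local Notation a_prev := 17.
Local Notation a_step := 18.
(* Arrays of elements of R, holding the multiples of 1, of alpha and of beta. *)
Local Notation a_nat := 2.
Local Notation a_alpha := (arr 3).
Local Notation a_beta := (arr 4).

Arguments foreach : simpl never.
Arguments arr : simpl never.

Definition Ifeq (e1 e2 : nexp) (c : cmd) : cmd :=
  If (Nle e1 e2) (If (Nle e2 e1) c Skip) Skip.

Section Program.
Local Open Scope nat_scope.
Variable g : nat.

Definition dim : nexp := Nget 0 (Nlit 0).
Definition idx : nexp := scalar a_idx.
Definition cur : nexp := scalar a_cur.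
Definition pow (r : nat) : nexp := Nget a_pow (Nlit r).
Definition succ (e : nexp) : nexp := Nadd e (Nlit 1).

Definition each_step (f : step -> cmd) : cmd :=
  foreach g (fun i => Seq (f (Drop i)) (Seq (f (Ins i)) (f (Keep i)))).

Definition tag (e : step) : nat :=
  match e with Drop i => 3 * i | Ins i => (3 * i).+1 | Keep i => (3 * i).+2 end.

Definition multiples (x : nat) (e : rexp) : cmd :=
  For a_idx dim (Rset x (succ idx) (Radd (Rget x idx) e)).

Definition real_tables : cmd :=
  Seq (multiples a_nat (Rlit 1))
    (foreach g (fun i => Seq (multiples (a_alpha i) (Rget 0 (Nlit i)))
                             (multiples (a_beta i) (Rget 1 (Nlit i))))).

Definition powers : cmd :=
  Seq (Nset a_pow (Nlit 0) (Nlit 1))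
    (foreach g.+3 (fun r => For a_idx (succ dim)
      (Nset a_pow (Nlit r.+1) (Nadd (pow r.+1) (pow r))))).

Definition target : cmd :=
  For a_idx dim (assign a_cur (Nadd cur
    (Nadd (pow 0) (Nadd (pow 2) (Nget a_pow (Nadd (Nlit 3) (Nget 2 idx))))))).

Definition fair_test : cmd :=
  let m := Nget (a_reg 2) idx in
  Seq (assign a_fair (Nlit 1))
    (If (Nle (Nget 0 (Nlit 1)) m)
      (foreach g (fun i => let c := Rget a_nat (Nget (a_reg i.+3) idx) in
        Seq (If (Rle (Radd c (Rlit 1)) (Rget (a_alpha i) m))
              (assign a_fair (Nlit 0)) Skip)
            (If (Rle (Radd (Rget (a_beta i) m) (Rlit 1)) c)
              (assign a_fair (Nlit 0)) Skip)))
      Skip).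

Definition extend (e : step) : cmd :=
  Seq (assign a_new (Nadd idx
         (Nadd (if reads e then pow 0 else pow 1)
               (if writes e then Nadd (pow 2) (pow (color e).+3) else Nlit 0))))
  (Seq (foreach g.+3 (fun r => Nset (a_reg r) (scalar a_new)
         (Nadd (Nget (a_reg r) idx) (Nlit (incr e r)))))
  (Seq (Nset a_seen (scalar a_new) (Nlit 1))
  (Seq (Nset a_pred (scalar a_new) idx)
       (Nset a_tag (scalar a_new) (Nlit (tag e)))))).

Definition try_step (e : step) : cmd :=
  let m := Nget (a_reg 2) idx in let j := Nget (a_reg 0) idx in
  let c := if writes e then If (Nle (succ m) dim) (extend e) Skip
           else extend e in
  if reads e then
    If (Nle (succ j) dim) (Ifeq (Nget 2 (Nget 1 j)) (Nlit (color e)) c) Skip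
  else c.

Definition search : cmd :=
  Seq (Nset a_seen (Nlit 0) (Nlit 1))
    (For a_idx (pow g.+3)
      (If (Nle (Nlit 1) (Nget a_seen idx))
        (Seq fair_test
          (If (Nle (Nlit 1) (scalar a_fair)) (each_step try_step) Skip))
        Skip)).

Definition least_target : cmd :=
  While (Nle (Nget a_seen cur) (Nlit 0)) (assign a_cur (Nadd cur (pow 1))).

Definition push (x n i : nat) (e : nexp) : cmd :=
  Seq (Nset (arr x i) (Nget n (Nlit i)) e)
      (Nset n (Nlit i) (succ (Nget n (Nlit i)))).

Definition record (e : step) : cmd :=
  let m := Nget (a_reg 2) (scalar a_prev) in
  let a := Nget 1 (Nget (a_reg 0) (scalar a_prev)) in
  match e with
  | Drop i => push 20 a_ndrp i a
  | Ins i => push 21 a_nins i m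
  | Keep _ => Nset a_out m a
  end.

Definition traceback : cmd :=
  While (Nle (Nlit 1) cur)
    (Seq (assign a_prev (Nget a_pred cur))
    (Seq (assign a_step (Nget a_tag cur))
    (Seq (each_step (fun e => Ifeq (scalar a_step) (Nlit (tag e)) (record e)))
         (assign a_cur (scalar a_prev))))).

Definition fill : cmd :=
  foreach g (fun i => For a_idx (Nget a_ndrp (Nlit i))
    (Nset a_out (Nget (a_ins i) idx) (Nget (a_drp i) idx))).

Definition program : cmd :=
  Seq real_tables (Seq powers (Seq target (Seq search
    (Seq least_target (Seq traceback fill))))).

End Program.

Lemma tag_inj : injective tag.
Proof. by case=> [i|i|i] [j|j|j]; rewrite /tag => ij; do ?[congr (_ _)];
  lia. Qed.

Ltac nowrite := rewrite /=; repeat first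
  [ done | by rewrite ?orbF arr_eq //=; lia | apply/norP; split | apply/andP;
    split
  | apply: nwrites_foreach => ? /= | apply: rwrites_foreach => ? /= | lia ].

Section Rules.
Local Open Scope nat_scope.
Variables (g : nat) (R : archiRealFieldType) (n : nat).
Implicit Types (s : store R).

Lemma run_ifeq e1 e2 c s (Q : store R -> Prop) :
    (neval s e1 = neval s e2 -> run n c s Q) ->
    (neval s e1 <> neval s e2 -> Q s) ->
  run n (Ifeq e1 e2 c) s Q.
Proof.
move=> run_c Qs; apply: run_if => /= [le12|gt12].
  apply: run_if => /= [le21|gt21].
    by apply: run_c; apply/eqP; rewrite eqn_leq le12.
  by apply/run_skip/Qs => eq12; rewrite eq12 leqnn in gt21.
by apply/run_skip/Qs => eq12; rewrite eq12 leqnn in gt12.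
Qed.

Lemma run_each_step f (I : nat -> store R -> Prop) s (Q : store R -> Prop) :
    I 0 s ->
    (forall e s', color e < g -> keeps (each_step g f) s s' -> I (tag e) s' ->
      run n (f e) s' (I (tag e).+1)) ->
    (forall s', keeps (each_step g f) s s' -> I (3 * g) s' -> Q s') ->
  run n (each_step g f) s Q.
Proof.
move=> I0 step_I end_I.
have sub i y : i < g -> ~~ nwrites (each_step g f) y ->
    ~~ nwrites (Seq (f (Drop i)) (Seq (f (Ins i)) (f (Keep i)))) y.
  move=> lt_i; rewrite /each_step; elim: (g) lt_i => // m IHm.
  by rewrite ltnS leq_eqVlt => /orP[/eqP->|/IHm le_m] /norP[? ?] //; apply:
    le_m.
have rsub i y : i < g -> ~~ rwrites (each_step g f) y ->
    ~~ rwrites (Seq (f (Drop i)) (Seq (f (Ins i)) (f (Keep i)))) y.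
  move=> lt_i; rewrite /each_step; elim: (g) lt_i => // m IHm.
  by rewrite ltnS leq_eqVlt => /orP[/eqP->|/IHm le_m] /norP[? ?] //; apply:
    le_m.
apply: (run_foreach (I := fun i => I (3 * i))) => // i s' lt_i k Ii.
apply: run_seq; apply: run_weaken (run_keeps (step_I (Drop i) _ lt_i k Ii)) _
  => s1 [I1 k1].
have{} k1 : keeps (each_step g f) s s1.
  apply: keeps_trans k _; split=> y.
    by move/(sub _ _ lt_i) => /norP[/k1.1].
  by move/(rsub _ _ lt_i) => /norP[/k1.2].
apply: run_seq.
apply: run_weaken (run_keeps (step_I (Ins i) _ lt_i k1 I1)) _ => s2 [I2 k2].
have{} k2 : keeps (each_step g f) s s2.
  apply: keeps_trans k1 _; split=> y.
    by move/(sub _ _ lt_i) => /norP[_ /norP[/k2.1]].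
  by move/(rsub _ _ lt_i) => /norP[_ /norP[/k2.2]].
by rewrite mulnS; apply: (step_I (Keep i) _ lt_i k2 I2).
Qed.

Lemma run_multiples x e d v s : d <= n -> nmem s 0 0 = d ->
    (forall s', keeps (multiples x e) s s' -> reval s' e = v) ->
    rmem s x 0 = 0%R ->
  run n (multiples x e) s
    (fun s' => forall m, m <= d -> rmem s' x m = (v *+ m)%R).
Proof.
move=> le_d s_d e_v x0.
apply: (run_for (I := fun i s' => forall m, m <= i -> rmem s' x m = (v *+ m)%R)
  (N := d)) => //.
- by move=> m; rewrite leqn0 => /eqP->.
- by move=> s' k; rewrite /= k.1.
- move=> i s' lt_i s'_i k Ii; apply: run_rset => m le_m.
  rewrite /= s'_i /upd eqxx addn1 (e_v _ k) Ii //.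
  by case: eqP => [->|ne_m] /=; [rewrite mulrSr | apply: Ii; lia].
Qed.

End Rules.

Section Correct.
Local Open Scope nat_scope.
Variables (g : nat) (R : archiRealFieldType) (d k : nat) (p lab : nat -> nat).
Variables al be : nat -> R.
Hypothesis lab_lt : forall a, a < d -> lab a < g.
Implicit Types (s : store R).

Definition fair_state (v : nat -> nat) : bool :=
  (k <= v 2) ==> all (fun i => ~~ ((v i.+3)%:R + 1 <= al i *+ v 2)%R
                            && ~~ (be i *+ v 2 + 1 <= (v i.+3)%:R)%R) (iota 0 g).

Lemma fair_state_ext v v' : (forall r, r < g.+3 -> v r = v' r) ->
  fair_state v = fair_state v'.
Proof.
move=> eq_v; rewrite /fair_state eq_v //; congr (_ ==> _).
by apply: eq_in_all => i; rewrite mem_iota => /andP[_ lt_i]; rewrite eq_v.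
Qed.

Let n := d.+1 ^ g.+3.
Local Notation valid := (valid g d p lab fair_state).
Local Notation code := (code g d).
Local Notation enabled := (enabled g d p lab fair_state).

Let le_n : d.+1 <= n.
Proof. by rewrite /n expnS leq_pmulr // expn_gt0. Qed.

Definition ready s : Prop :=
  [/\ nmem s 0 0 = d, nmem s 0 1 = k, nmem s 1 = p & nmem s 2 = lab] /\
  [/\ forall r, r <= g.+3 -> nmem s a_pow r = d.+1 ^ r,
      forall m, m <= d -> rmem s a_nat m = m%:R%R,
      forall i m, i < g -> m <= d -> rmem s (a_alpha i) m = (al i *+ m)%R &
      forall i m, i < g -> m <= d -> rmem s (a_beta i) m = (be i *+ m)%R].

Lemma ready_keeps c s s' : keeps c s s' ->
    [&& ~~ nwrites c 0, ~~ nwrites c 1, ~~ nwrites c 2 & ~~ nwrites c a_pow] ->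
    (forall y, ~~ rwrites c y) ->
  ready s -> ready s'.
Proof.
move=> [kn kr] /and4P[c0 c1 c2 c5] cr [[s0 s1 s2 s3] [s4 s5 s6 s7]].
rewrite /ready !kn //; split=> //.
by split=> // *; rewrite kr ?(s5, s6, s7).
Qed.

Lemma run_real_tables s : nmem s 0 0 = d -> (forall i, i < g ->
  rmem s 0 i = al i) ->
    (forall i, i < g -> rmem s 1 i = be i) -> (forall y, 2 <= y ->
      rmem s y 0 = 0%R) ->
  run n (real_tables g) s (fun s' =>
    [/\ forall m, m <= d -> rmem s' a_nat m = m%:R%R,
        forall i m, i < g -> m <= d -> rmem s' (a_alpha i) m = (al i *+ m)%R &
        forall i m, i < g -> m <= d -> rmem s' (a_beta i) m = (be i *+ m)%R]).
Proof.
move=> s_d s_al s_be s0; have le_d := ltnW le_n; apply: run_seq.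
have run_nat := run_multiples (e := Rlit 1) le_d s_d (fun _ _ =>
  erefl) (s0 2 isT).
apply: run_weaken (run_keeps run_nat) _ => s1 [s1_nat k1].
pose I i s' := [/\ forall j m, j < i -> m <= d ->
  rmem s' (a_alpha j) m = (al j *+ m)%R,
  forall j m, j < i -> m <= d -> rmem s' (a_beta j) m = (be j *+ m)%R,
  forall j, i <= j -> rmem s' (a_alpha j) 0 = 0%R &
  forall j, i <= j -> rmem s' (a_beta j) 0 = 0%R].
apply: (run_foreach (I := I)).
- split=> // j _; rewrite k1.2 /= ?s0 // ?/arr; lia.
- move=> i s' lt_i k' [Ia Ib Za Zb]; apply: run_seq.
  have s'_d : nmem s' 0 0 = d by rewrite k'.1 ?k1.1 //; nowrite.
  have s'_al : rmem s' 0 i = al i by rewrite k'.2 ?k1.2 ?s_al //; nowrite.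
  have s'_be : rmem s' 1 i = be i by rewrite k'.2 ?k1.2 ?s_be //; nowrite.
  have kal s2 : keeps (multiples (a_alpha i) (Rget 0 (Nlit i))) s' s2 ->
      reval s2 (Rget 0 (Nlit i)) = al i by move=> k2; rewrite /= k2.2.
  apply: run_weaken (run_keeps (run_multiples le_d s'_d kal (Za _ _))) _ => //=.
  move=> s2 [s2_al k2].
  have kbe s3 : keeps (multiples (a_beta i) (Rget 1 (Nlit i))) s2 s3 ->
      reval s3 (Rget 1 (Nlit i)) = be i by move=> k3; rewrite /= k3.2 ?k2.2.
  have s2_d : nmem s2 0 0 = d by rewrite k2.1.
  have Zb2 : rmem s2 (a_beta i) 0 = 0%R by rewrite k2.2 ?Zb //; nowrite.
  apply: run_weaken (run_keeps (run_multiples le_d s2_d kbe Zb2)) _ => //=.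
  move=> s3 [s3_be k3]; split=> j.
  - move=> m lt_j le_m; rewrite k3.2; last by nowrite.
    have [->|ne_j] := eqVneq j i; first exact: s2_al.
    by rewrite k2.2 ?Ia //; nowrite.
  - move=> m lt_j le_m; have [->|ne_j] := eqVneq j i; first exact: s3_be.
    by rewrite k3.2 ?k2.2 ?Ib //; nowrite.
  - by move=> lt_j; rewrite k3.2 ?k2.2 ?Za //; nowrite.
  by move=> lt_j; rewrite k3.2 ?k2.2 ?Zb //; nowrite.
move=> s' k' [Ia Ib _ _]; split=> //.
by move=> m le_m; rewrite k'.2 ?s1_nat //; nowrite.
Qed.

Lemma run_powers s : nmem s 0 0 = d -> (forall r, nmem s a_pow r = 0) ->
  run n (powers g) s (fun s' => forall r, r <= g.+3 ->
    nmem s' a_pow r = d.+1 ^ r).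
Proof.
move=> s_d s0; apply: run_seq; apply: run_nset => /=.
pose I r s' := (forall j, j <= r -> nmem s' a_pow j = d.+1 ^ j) /\
               (forall j, r < j -> nmem s' a_pow j = 0).
apply: (run_foreach (I := I)) => [|r s' lt_r k' [Ir Zr]|s' _ []//].
  split=> j; first by rewrite leqn0 => /eqP->.
  by case: j => //= j _; rewrite /upd /= s0.
pose J x s' := [/\ forall j, j <= r -> nmem s' a_pow j = d.+1 ^ j,
  nmem s' a_pow r.+1 = x * d.+1 ^ r & forall j, r.+1 < j ->
    nmem s' a_pow j = 0].
apply: (run_for (I := J) (N := d.+1)) => //.
- by split=> // [|j lt_j]; rewrite Zr ?mul0n //; lia.
- move=> s2 k2; rewrite /= addn1 k2.1 //= k'.1 /=; last by nowrite.
  by rewrite /upd /= s_d.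
- move=> x s2 lt_x s2_x k2 [Ix Jx Zx]; apply: run_nset; split=>
    [j le_j||j lt_j].
  + by rewrite /= /upd /= ifN ?Ix //; lia.
  + by rewrite /= /upd !eqxx Jx Ix // mulSn addnC.
  by rewrite /= /upd /= ifN ?Zx //; lia.
move=> s2 k2 [I2 J2 Z2]; split=> // j.
by rewrite leq_eqVlt ltnS => /orP[/eqP->|/I2//]; rewrite J2 expnS.
Qed.

(* A path without insertions whose registers are those of a complete path,
   except that it may be unfair; its code is therefore that of the final state
   with 0 insertions. *)
Definition keep_all (m : nat) : seq step := [seq Keep (lab a) | a <- rev (iota
  0 m)].

Lemma run_target s : ready s -> nmem s a_cur 0 = 0 ->
  run n target s (fun s' => nmem s' a_cur 0 = code (vec (keep_all d))).
Proof.
move=> rs s_cur.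
pose I i s' := nmem s' a_cur 0 = code (vec (keep_all i)).
apply: (run_for (I := I) (N := d)) => //; first exact: ltnW.
- by rewrite /I s_cur code_nil.
- by move=> s' k'; rewrite /= k'.1 //; case: rs => [[]].
move=> i s' lt_i s'_i k' Ii; apply: run_nset.
have [[_ _ _ s'_lab] [s'_pow _ _ _]] : ready s' by apply: ready_keeps k' _ _ rs.
have lt_lab := lab_lt lt_i; have le_lab : 3 + lab i <= g.+3 by lia.
rewrite /I /= /upd !eqxx s'_i s'_lab !s'_pow // Ii.
by rewrite /keep_all iota0_rcons rev_rcons /= code_cons // /delta /= addnA.
Qed.


Definition seen s y : bool := 0 < nmem s a_seen y.

Definition holds s y (v : nat -> nat) : Prop :=
  forall r, r < g.+3 -> nmem s (a_reg r) y = v r.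

Definition entry s y rs : Prop :=
  [/\ valid rs, code (vec rs) = y, holds s y (vec rs) &
      if rs is e :: rs' then
        [/\ nmem s a_pred y = code (vec rs'), nmem s a_tag y = tag e &
            seen s (code (vec rs'))]
      else True].

Definition table s : Prop :=
  seen s 0 /\ forall y, seen s y -> exists rs, entry s y rs.

Lemma valid_vec_le rs r : valid rs -> r < g.+3 -> vec rs r <= d.
Proof. by move=> v_rs _; apply: valid_le v_rs. Qed.

Lemma valid_code_inj rs rs' : valid rs -> valid rs' ->
  code (vec rs) = code (vec rs') -> forall r, r < g.+3 -> vec rs r = vec rs' r.
Proof. by move=> v v'; apply: code_inj => r; apply: valid_vec_le. Qed.

Lemma run_fair_test s x rs : ready s -> nmem s a_idx 0 = x ->
  holds s x (vec rs) ->
    vec rs 2 <= d -> (forall i, vec rs i.+3 <= d) ->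
  run n (fair_test g) s (fun s' => (0 < nmem s' a_fair 0) = fair_state (vec
    rs)).
Proof.
move=> rs_s s_x s_rs le2 lec; apply: run_seq; apply: run_nset.
set s1 := nset _ _ _ _.
have r1 : ready s1 by [].
have x1 : nmem s1 a_idx 0 = x by [].
have h1 : holds s1 x (vec rs) by move=> r lt_r; rewrite -s_rs.
have f1 : nmem s1 a_fair 0 = 1 by [].
move: s1 r1 x1 h1 f1 => s1 r1 x1 h1 f1 {s rs_s s_x s_rs}.
have [[_ s1_k _ _] _] := r1.
rewrite /fair_state; apply: run_if => /=; rewrite s1_k x1 h1 //; last first.
  by move/negPf=> ->; apply: run_skip; rewrite f1.
move=> -> /=; pose ok i := ~~ ((vec rs i.+3)%:R + 1 <= al i *+ vec rs 2)%R
  && ~~ (be i *+ vec rs 2 + 1 <= (vec rs i.+3)%:R)%R.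
pose I i s' := (0 < nmem s' a_fair 0) = all ok (iota 0 i).
apply: (run_foreach (I := I)) => [|i s2 lt_i k2 I2|s2 _ //];
  first by rewrite /I f1.
have [_ [_ s1_nat s1_al s1_be]] := r1.
have [s2x s2_2 s2_c] : [/\ nmem s2 a_idx 0 = x, nmem s2 (a_reg 2) x = vec rs 2 &
    nmem s2 (a_reg i.+3) x = vec rs i.+3].
  by split; rewrite k2.1 ?h1 //; nowrite.
have s2_r y : rmem s2 y = rmem s1 y by rewrite k2.2 //; nowrite.
apply: run_seq; rewrite /I iota0_rcons all_rcons -I2.
pose B1 := Rle (Radd (Rget a_nat (Nget (a_reg i.+3) idx)) (Rlit 1))
  (Rget (a_alpha i) (Nget (a_reg 2) idx)).
pose B2 := Rle (Radd (Rget (a_beta i) (Nget (a_reg 2) idx)) (Rlit 1))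
  (Rget a_nat (Nget (a_reg i.+3) idx)).
have -> : ok i = ~~ beval s2 B1 && ~~ beval s2 B2.
  by rewrite /= s2x s2_2 s2_c !s2_r s1_nat // s1_al // s1_be.
apply: run_if => b1; [apply: run_nset | apply: run_skip]; apply: run_if => b2.
- by apply: run_nset; rewrite [beval s2 B1]b1.
- by apply: run_skip; rewrite [beval s2 B1]b1.
- by apply: run_nset; rewrite [beval s2 B2]b2 andbF.
by apply: run_skip; rewrite [beval s2 B1](negPf b1) [beval s2 B2](negPf b2).
Qed.

Lemma code_new s e rs : ready s -> color e < g ->
    nmem s a_idx 0 = code (vec rs) ->
  neval s (Nadd idx (Nadd (if reads e then pow 0 else pow 1)
    (if writes e then Nadd (pow 2) (pow (color e).+3) else Nlit 0)))
  = code (vec (e :: rs)).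
Proof.
move=> [_ [s_pow _ _ _]] lt_e s_idx; rewrite code_cons // -s_idx /delta /=.
by case: e lt_e => i lt_i /=; rewrite !s_pow ?expn1 ?expn0 //; apply: ltnW.
Qed.

Lemma run_extend s e rs : ready s -> table s ->
  nmem s a_idx 0 = code (vec rs) ->
    seen s (code (vec rs)) -> holds s (code (vec rs)) (vec rs) -> valid (e :: rs) ->
  run n (extend g e) s (fun s' =>
    [/\ table s', seen s' (code (vec (e :: rs))), forall y, seen s y -> seen s' y &
        holds s' (code (vec rs)) (vec rs)]).
Proof.
move=> rs_s tab s_x seen_x hx v_e; have /andP[/and4P[lt_e _ _ _] v_rs] := v_e.
set x := code (vec rs) in s_x seen_x hx *; set y := code (vec (e :: rs)).
have ne_xy : x != y.
  by rewrite /x /y code_cons // -[X in X == _]addn0 eqn_add2l eq_sym -lt0n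
    delta_gt0.
apply: run_seq; apply: run_nset; rewrite (code_new rs_s lt_e s_x) -/y; apply:
  run_seq.
set s1 := nset _ _ _ _.
pose I i s' := (forall r, r < i -> nmem s' (a_reg r) y = vec (e :: rs) r) /\
  (forall r z, (i <= r) || (z != y) -> nmem s' (a_reg r) z = nmem s (a_reg r)
    z).
apply: (run_foreach (I := I)) => // [i s2 lt_i k2 [I2 Z2]|s2 k2 [I2 Z2]].
  have [s2x s2y] : nmem s2 a_idx 0 = x /\ nmem s2 a_new 0 = y.
    by split; rewrite k2.1 //; nowrite.
  apply: run_nset; split=> /= [r lt_r|r z r_z]; rewrite /upd s2x s2y arr_eq //=.
    rewrite eqxx andbT Z2 ?ne_xy ?orbT // hx // vec_cons addnC.
    by case: eqP => [->//|ne_r]; apply: I2; lia.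
  by rewrite ifN ?Z2 //; move: r_z; have := ne_xy; lia.
have [s2x s2y] : nmem s2 a_idx 0 = x /\ nmem s2 a_new 0 = y.
  by split; rewrite k2.1 //; nowrite.
have [s2s s2p s2t] : [/\ nmem s2 a_seen = nmem s a_seen,
  nmem s2 a_pred = nmem s a_pred &
    nmem s2 a_tag = nmem s a_tag] by split; rewrite k2.1 //; nowrite.
apply: run_seq; apply: run_nset; apply: run_seq; apply: run_nset; apply:
  run_nset.
set s3 := nset _ _ _ _.
have [s3s s3p s3t s3r] : [/\ forall z, nmem s3 a_seen z = if z == y then 1 else
  nmem s a_seen z,
    forall z, nmem s3 a_pred z = if z == y then x else nmem s a_pred z,
    forall z, nmem s3 a_tag z = if z == y then tag e else nmem s a_tag z &
    forall r, nmem s3 (a_reg r) = nmem s2 (a_reg r)].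
  by split=> *; rewrite /s3 /= /upd /= ?s2x ?s2y ?s2s ?s2p ?s2t.
have mono z : seen s z -> seen s3 z by rewrite /seen s3s; case: ifP.
split=> //; last 2 first.
- by rewrite /seen s3s eqxx.
- by move=> r lt_r; rewrite s3r Z2 ?ne_xy ?orbT // hx.
split=> [|z]; first by apply: mono; case: tab.
rewrite {1}/seen s3s; have [-> _|ne_z] := eqVneq z y.
  exists (e :: rs); split=> //.
  by rewrite s3p s3t eqxx; split=> //; apply: mono.
case: tab => _ /[apply] -[rs' [v' c' h' e']]; exists rs'; split=> //.
  by move=> r lt_r; rewrite s3r Z2 ?ne_z ?orbT // h'.
case: rs' e' {v' c' h'} => // e' rs' [p' t' s']; split; last exact: mono.
  by rewrite s3p (negPf ne_z).
by rewrite s3t (negPf ne_z).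
Qed.

Lemma run_try s e rs (Q : store R -> Prop) : ready s ->
    nmem s a_idx 0 = code (vec rs) -> holds s (code (vec rs)) (vec rs) ->
    color e < g -> fair_state (vec rs) -> valid rs ->
    (valid (e :: rs) -> run n (extend g e) s Q) ->
    (~~ valid (e :: rs) -> Q s) ->
  run n (try_step g e) s Q.
Proof.
move=> [[s_d _ s_p s_lab] _] s_x hx lt_e f_rs v_rs run_e Qs.
rewrite /= /enabled lt_e f_rs v_rs !andbT /= in run_e Qs.
have h0 := hx 0 isT; have h2 := hx 2 isT.
have gd i c : neval s (succ (Nget (a_reg i) idx)) = (vec rs i).+1 ->
    (vec rs i < d -> run n c s Q) -> (~~ (vec rs i < d) -> Q s) ->
    run n (If (Nle (succ (Nget (a_reg i) idx)) dim) c Skip) s Q.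
  move=> ev run_c Q_s; apply: run_if => /=; move: ev => /= ->; rewrite s_d =>
    //.
  by move/Q_s; apply: run_skip.
have e0 : neval s (succ (Nget (a_reg 0) idx)) = (vec rs 0).+1.
  by rewrite /= s_x h0 addn1.
have e2 : neval s (succ (Nget (a_reg 2) idx)) = (vec rs 2).+1.
  by rewrite /= s_x h2 addn1.
have lb : neval s (Nget 2 (Nget 1 (Nget (a_reg 0) idx))) = lab (p (vec rs 0)).
  by rewrite /= s_x h0 s_p s_lab.
case: e lt_e run_e Qs => i lt_i /= run_e Qs; rewrite /try_step /=.
- apply: (gd _ _ e0) => [lt0|/negPf nlt]; last by apply: Qs; rewrite nlt.
  apply: run_ifeq; rewrite lb /= => lab_i.
    by apply: run_e; rewrite lt0 lab_i eqxx.
  by apply: Qs; rewrite lt0; move/eqP/negPf: lab_i => ->.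
- apply: (gd _ _ e2) => [lt2|/negPf nlt]; last by apply: Qs; rewrite nlt.
  by apply: run_e; rewrite lt2.
apply: (gd _ _ e0) => [lt0|/negPf nlt]; last by apply: Qs; rewrite nlt.
apply: run_ifeq; rewrite lb /= => lab_i; last first.
  by apply: Qs; rewrite lt0; move/eqP/negPf: lab_i => ->.
apply: (gd _ _ e2) => [lt2|/negPf nlt]; last by apply: Qs; rewrite nlt andbF.
by apply: run_e; rewrite lt0 lt2 lab_i eqxx.
Qed.

Lemma run_search s : ready s -> (forall y, nmem s a_seen y = 0) ->
    (forall r, nmem s (a_reg r) 0 = 0) ->
  run n (search g) s (fun s' => table s' /\
    forall rs, valid rs -> seen s' (code (vec rs))).
Proof.
move=> r0 seen0 reg0; apply: run_seq; apply: run_nset => /=;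
  set s1 := nset _ _ _ _.
have r1 : ready s1 by [].
have seen1 y : seen s1 y = (y == 0) by rewrite /seen /s1 /= /upd /= seen0;
  case: eqP.
pose done x s' := forall e rs, valid (e :: rs) -> code (vec rs) < x ->
  seen s' (code (vec (e :: rs))).
have reached x s' rs : seen s' 0 -> done x s' -> valid rs ->
  code (vec rs) <= x ->
    seen s' (code (vec rs)).
  case: rs => [|e rs] s0 dn v_rs le_x; first by rewrite code_nil.
  apply: dn => //; have /andP[/and4P[lt_e _ _ _] _] := v_rs.
  by move: le_x; rewrite code_cons //; have := delta_gt0 d e; lia.
pose I x s' := table s' /\ done x s'.
apply: (run_for (I := I) (N := n)) => //.
- by nowrite.
- split=> [|? ? _]; last by rewrite ltn0.
  split=> [|y]; rewrite seen1 // => /eqP->; exists [::]; split=> //.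
    exact: code_nil.
  by move=> r lt_r; rewrite /s1 /= /upd /= reg0.
- move=> s' k'; have [_ [s1_pow _ _ _]] := r1.
  by rewrite /= k'.1 ?s1_pow //; nowrite.
- move=> x s' lt_x s'_x k' [tab dn].
  have r' : ready s'.
    apply: (ready_keeps k' _ _ r1); first by nowrite.
    by move=> y; nowrite.
  have seen0' : seen s' 0 by case: tab.
  apply: run_if => /=; rewrite s'_x => seen_x; last first.
    apply: run_skip; split=> // e rs v_e; rewrite ltnS leq_eqVlt =>
      /predU1P[cx|]; last exact: dn.
    by case/negP: seen_x; rewrite -cx; apply: reached dn _ _; rewrite ?cx //;
      case/andP: v_e.
  have [rs0 [v0 c0 h0 _]] := tab.2 x seen_x.
  have ext0 e rs : valid (e :: rs) -> code (vec rs) = x ->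
      valid (e :: rs0) /\ code (vec (e :: rs)) = code (vec (e :: rs0)).
    case/andP=> en_e v_rs cx.
    have eq_v := valid_code_inj v_rs v0 (etrans cx (esym c0)).
    rewrite /= v0 andbT -(enabled_ext _ _ _ fair_state_ext _ eq_v) en_e; split=> //.
    by have /and4P[lt_e _ _ _] := en_e; rewrite !code_cons // cx c0.
  apply: run_seq.
  have le_c i : vec rs0 i <= d by apply: valid_le v0.
  apply: run_weaken (run_keeps (run_fair_test r' s'_x h0 (le_c _) (fun _ =>
    le_c _))) _.
  move=> s2 [s2_fair k2].
  have r2 : ready s2.
    apply: (ready_keeps k2 _ _ r'); first by nowrite.
    by move=> y; nowrite.
  have s2_idx : nmem s2 a_idx 0 = x by rewrite k2.1 //; nowrite.
  have [k2s k2p k2t k2r] : [/\ nmem s2 a_seen = nmem s' a_seen,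
    nmem s2 a_pred = nmem s' a_pred,
      nmem s2 a_tag = nmem s' a_tag & forall r,
        nmem s2 (a_reg r) = nmem s' (a_reg r)].
    by split=> *; rewrite k2.1 //; nowrite.
  have seen2 y : seen s2 y = seen s' y by rewrite /seen k2s.
  have tab2 : table s2.
    split=> [|y]; rewrite seen2 // => /(tab.2)[rs [v c h e]]; exists rs; split=> //.
      by move=> r lt_r; rewrite k2r h.
    by case: rs e {v c h} => // e rs []; rewrite k2p k2t seen2.
  have dn2 : done x s2 by move=> e rs v c; rewrite seen2; apply: dn.
  have h2 : holds s2 x (vec rs0) by move=> r lt_r; rewrite k2r h0.
  apply: run_if => /=; rewrite s2_fair => f0; last first.
    apply: run_skip; split=> // e rs v_e; rewrite ltnS leq_eqVlt =>
      /predU1P[cx|]; last exact: dn2.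
    have [/andP[/and4P[_ _ _ f_e] _] _] := ext0 _ _ v_e cx.
    by rewrite f_e in f0.
  pose J t s' := [/\ table s', done x s', seen s' x, holds s' x (vec rs0) &
    forall e, tag e < t -> valid (e :: rs0) -> seen s' (code (vec (e :: rs0)))].
  apply: (run_each_step (I := J)); first by rewrite /J seen2.
    move=> e s3 lt_e k3 [tab3 dn3 sx3 h3 J3].
    have r3 : ready s3.
      apply: (ready_keeps k3 _ _ r2); first by nowrite.
      by move=> y; nowrite.
    have s3_idx : nmem s3 a_idx 0 = code (vec rs0).
      by rewrite k3.1 ?s2_idx ?c0 //; nowrite.
    have J_e s4 : (forall y, seen s3 y -> seen s4 y) ->
        (valid (e :: rs0) -> seen s4 (code (vec (e :: rs0)))) ->
        forall e', tag e' < (tag e).+1 -> valid (e' :: rs0) ->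
          seen s4 (code (vec (e' :: rs0))).
      move=> mono s4_e e'; rewrite ltnS leq_eqVlt =>
        /predU1P[/tag_inj->//|lt_e'] v_e'.
      exact: mono (J3 _ lt_e' v_e').
    apply: (run_try (rs := rs0)) => //; rewrite ?c0 // => v_e.
      have := run_extend r3 tab3 s3_idx; rewrite c0 => /(_ e sx3 h3 v_e) run_e.
      apply: run_weaken run_e _ => s4 [tab4 s4_e mono h4]; split=> //.
      - by move=> e' rs' v' c'; apply: mono; apply: dn3.
      - exact: mono.
      by apply: J_e => //.
    by split=> //; apply: J_e => // v_e'; rewrite v_e' in v_e.
  move=> s4 _ [tab4 dn4 _ _ J4]; split=> // e rs v_e.
  rewrite ltnS leq_eqVlt => /predU1P[cx|]; last exact: dn4.
  have [v_e0 ->] := ext0 _ _ v_e cx; apply: J4 => //.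
  by have /andP[/and4P[lt_e _ _ _] _] := v_e0; case: (e) lt_e => i /=; lia.
move=> s' _ [tab dn]; split=> // rs v_rs; apply: (reached _ _ _ _ dn v_rs);
  first by case: tab.
by apply/ltnW/code_lt => r; apply: valid_vec_le.
Qed.


Definition complete rs : Prop :=
  [/\ valid rs, vec rs 0 = d, vec rs 2 = d &
      forall i, i < g -> vec rs i.+3 = count (fun a => lab a == i) (iota 0 d)].

Definition target_vec (m r : nat) : nat :=
  match r with
  | 0 => d | 1 => m | 2 => d | i.+3 => count (fun a => lab a == i) (iota 0 d)
  end.

Lemma complete_vec rs : complete rs ->
  forall r, r < g.+3 -> vec rs r = target_vec (vec rs 1) r.
Proof. by case=> _ e0 e2 ec [|[|[|i]]] //; rewrite !ltnS; apply: ec. Qed.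

Lemma keep_all_vec r : vec (keep_all d) r = target_vec 0 r.
Proof.
rewrite /keep_all /target_vec; elim: d => [|m IHm]; first by case: r =>
  [|[|[|]]].
rewrite iota0_rcons rev_rcons /= vec_cons IHm.
case: r {IHm} => [|[|[|i]]] //; rewrite -cats1 count_cat /=.
by rewrite addn0 addnC.
Qed.

Lemma code_target m : code (target_vec m.+1) = code (target_vec m) + d.+1.
Proof.
rewrite /code !big_ord_recl /= /bump /= mulSn expn1.
set S := \sum_(i < g) _; set T := d * _ ^ (1 + (1 + 0)); set U := d * _ ^ 0.
lia.
Qed.

Lemma run_least_target s rs1 : ready s -> table s ->
    (forall rs, valid rs -> seen s (code (vec rs))) -> complete rs1 ->
    nmem s a_cur 0 = code (vec (keep_all d)) ->
  run n least_target s (fun s' => exists rs,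
    [/\ complete rs, nmem s' a_cur 0 = code (vec rs) &
        forall rs', complete rs' -> vec rs 1 <= vec rs' 1]).
Proof.
move=> rd tab all_seen c1 s_cur.
have cT rs : complete rs -> code (vec rs) = code (target_vec (vec rs 1)).
  by move=> c; apply/eq_code/complete_vec.
have [v1 _ _ _] := c1.
pose I j s' := exists m, [/\ m + j = vec rs1 1,
  nmem s' a_cur 0 = code (target_vec m) &
  forall m', m' < m -> ~~ seen s (code (target_vec m'))].
apply: (run_while (I := I) (m := vec rs1 1)).
- by apply: leq_trans (ltnW le_n); apply: valid_le v1.
- exists 0; split=> //; rewrite s_cur; apply: eq_code => r _; exact:
    keep_all_vec.
- move=> j s' /= b_s' k' [m [mj s'_cur unseen]]; move: b_s'.
  rewrite s'_cur k'.1 // -[_ <= 0]negbK -ltnNge -/(seen s _) => nseen.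
  case: j mj => [|j] mj.
    by case/negP: nseen; rewrite addn0 in mj; rewrite mj -cT // all_seen.
  exists j => //; apply: run_nset; exists m.+1; split=> [||m']; first by lia.
    have [_ [s_pow _ _ _]] := rd.
    by rewrite /= /upd /= s'_cur k'.1 // s_pow // expn1 code_target.
  by rewrite ltnS leq_eqVlt => /predU1P[->|/unseen].
move=> j s' /= b_s' k' [m [mj s'_cur unseen]]; move: b_s'.
rewrite s'_cur k'.1 // -ltnNge -/(seen s _) => /(tab.2)[rs [v c h _]].
have le_m : m <= d by apply: leq_trans (valid_le 1 v1); lia.
have T_le r : r < g.+3 -> target_vec m r <= d.
  case: r => [|[|[|i]]] //= _; rewrite -[X in _ <= X](size_iota 0 d); exact:
    count_size.
have vT := code_inj (fun r => valid_vec_le v) T_le c.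
exists rs; split=> [||rs' c'].
- by split=> //; [apply: (vT 0) | apply: (vT 2) | move=> i lt_i; apply:
    (vT i.+3)].
- by rewrite c.
rewrite (vT 1) //= leqNgt; apply/negP => /unseen/negP; apply.
by rewrite -cT //; apply: all_seen; case: c'.
Qed.

Fixpoint traced s rs : Prop :=
  if rs is e :: rs' then
    [/\ nmem s a_pred (code (vec rs)) = code (vec rs'),
        nmem s a_tag (code (vec rs)) = tag e,
        holds s (code (vec rs')) (vec rs') & traced s rs']
  else True.

Lemma table_traced s rs : table s -> valid rs -> seen s (code (vec rs)) ->
  exists rs', [/\ valid rs', forall r, r < g.+3 ->
    vec rs' r = vec rs r & traced s rs'].
Proof.
move=> tab; have [y] := ubnP (code (vec rs)); elim: y rs =>
  // y IHy rs lt_y v_rs.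
move=> seen_rs; have [rs1 [v1 c1 h1 e1]] := tab.2 _ seen_rs.
have eq1 := valid_code_inj v1 v_rs c1.
case: rs1 v1 c1 h1 e1 eq1 => [|e rs2] v1 c1 h1 e1 eq1; first by exists [::].
have /andP[en_e v2] := v1; have /and4P[lt_e _ _ _] := en_e; case: e1 =>
  p1 t1 s2.
have [|rs3 [v3 eq3 tr3]] := IHy rs2 _ v2 s2.
  by move: lt_y; rewrite -c1 code_cons //; have := delta_gt0 d e; lia.
have eq_r r : r < g.+3 -> vec (e :: rs3) r = vec (e :: rs2) r.
  by move=> lt_r; rewrite !vec_cons eq3.
have c3 : code (vec (e :: rs3)) = code (vec rs) by rewrite (eq_code _ eq_r).
have eq23 : code (vec rs3) = code (vec rs2) by apply: eq_code.
exists (e :: rs3); split.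
- by rewrite /= v3 andbT (enabled_ext _ _ _ fair_state_ext _ eq3).
- by move=> r lt_r; rewrite eq_r // eq1.
rewrite /= c3 p1 t1 eq23; split=> // r lt_r.
have [rs4 [v4 c4 h4 _]] := tab.2 _ s2.
by rewrite h4 // eq3 // (valid_code_inj v4 v2 c4).
Qed.

Lemma assoc_uniq (L : seq (nat * nat)) x a b :
  uniq (unzip1 L) -> (x, a) \in L -> (x, b) \in L -> a = b.
Proof.
elim: L => //= -[y c] L IHL /andP[/= yL uL]; rewrite !inE !xpair_eqE.
have mem1 z : (y, z) \in L -> false by move/(map_f fst); rewrite (negPf yL).
case/orP=> [/andP[/eqP-> /eqP->]|xa] /orP[/andP[/eqP xy /eqP eb]|xb] //.
- by move/mem1: xb.
- by rewrite xy in xa; move/mem1: xa.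
exact: IHL.
Qed.

Lemma write_assoc (L pre : seq (nat * nat)) (f : nat -> nat) x a :
    uniq (unzip1 L) -> {subset pre <= L} -> (x, a) \in L ->
    (forall yb, yb \in pre -> f yb.1 = yb.2) ->
  forall yb, (yb == (x, a)) || (yb \in pre) ->
    (if yb.1 == x then a else f yb.1) = yb.2.
Proof.
move=> uL sub xa f_pre [y b] /= /orP[/eqP[-> ->]|yb]; first by rewrite eqxx.
case: eqP => [yx|_]; last exact: f_pre yb.
by rewrite -yx in xa; apply: assoc_uniq uL xa (sub _ yb).
Qed.

Definition stored s (x c i : nat) : seq nat :=
  [seq nmem s (arr x i) t | t <- iota 0 (nmem s c i)].

Lemma run_push s x c i e : c < x < 32 ->
  run n (push x c i e) s (fun s' => forall j,
    stored s' x c j = if j == i then rcons (stored s x c i) (neval s e)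
                      else stored s x c j).
Proof.
case/andP=> lt_c lt_x; have ne j : (c == arr x j) = false by rewrite /arr; lia.
have ne' j : (arr x j == c) = false by rewrite eq_sym.
apply: run_seq; apply: run_nset; apply: run_nset => j.
rewrite /stored /= /upd /= !eqxx !ne !ne' /=; have [->|ne_j] := eqVneq j i.
  rewrite addn1 iota0_rcons map_rcons !eqxx; congr rcons; apply/eq_in_map => t.
  by rewrite mem_iota /= => lt_t; rewrite ifN //; lia.
by apply/eq_map => t; rewrite arr_eq // eqxx (negPf ne_j).
Qed.

Section Trace.
Variable rs : seq step.
Hypotheses (v_rs : valid rs) (rs0 : vec rs 0 = d) (rs2 : vec rs 2 = d).
Hypothesis rsc : forall i, i < g ->
  vec rs i.+3 = count (fun a => lab a == i) (map p (iota 0 d)).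
Local Notation assignment := (assignment g p rs).

Lemma assignment_uniq : uniq (unzip1 assignment).
Proof. by rewrite (perm_uniq (assignment_positions v_rs rs0 rs2 rsc))
  iota_uniq. Qed.

Definition written s (L : seq (nat * nat)) : Prop :=
  forall xa, xa \in L -> nmem s a_out xa.1 = xa.2.

(* The steps in front of the suffix r of rs have been traced back. *)
Definition recorded s (r : seq step) : Prop :=
  [/\ forall i, stored s 20 a_ndrp i ++ drp p i r = drp p i rs,
      forall i, stored s 21 a_nins i ++ ins i r = ins i rs &
      exists2 pre, kept p rs = pre ++ kept p r & written s pre].

Lemma recorded_eq s s' r : nmem s' a_out = nmem s a_out ->
    nmem s' a_ndrp = nmem s a_ndrp -> nmem s' a_nins = nmem s a_nins ->
    (forall i, nmem s' (a_drp i) = nmem s (a_drp i)) ->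
    (forall i, nmem s' (a_ins i) = nmem s (a_ins i)) ->
  recorded s r -> recorded s' r.
Proof.
move=> e1 e2 e3 e4 e5 [r1 r2 [pre r3 r4]]; split.
- by move=> i; rewrite /stored e2 e4 -r1.
- by move=> i; rewrite /stored e3 e5 -r2.
by exists pre => // xa xa_pre; rewrite e1 r4.
Qed.

Lemma run_record s e r : nmem s 1 = p -> nmem s a_prev 0 = code (vec r) ->
    holds s (code (vec r)) (vec r) -> recorded s (e :: r) ->
  run n (record e) s (fun s' => recorded s' r).
Proof.
move=> s_p s_prev hr [r1 r2 [pre r3 r4]].
have h0 := hr 0 isT; have h2 := hr 2 isT.
case: e r1 r2 r3 => i r1 r2 r3.
- have run_i := run_push s i (Nget 1 (Nget (a_reg 0) (scalar a_prev)))
    (x := 20) (c := a_ndrp) isT.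
  apply: run_weaken (run_keeps run_i) _ => s' [s'_st k']; split=> [j|j|].
  + rewrite s'_st -r1 /= s_prev h0 s_p.
    by case: eqP => [->|_] //; rewrite cat_rcons.
  + by rewrite -r2 /= /stored !k'.1 //; nowrite.
  by exists pre => // xa /r4; rewrite k'.1 //; nowrite.
- have run_i := run_push s i (Nget (a_reg 2) (scalar a_prev))
    (x := 21) (c := a_nins) isT.
  apply: run_weaken (run_keeps run_i) _ => s' [s'_st k']; split=> [j|j|].
  + by rewrite -r1 /= /stored !k'.1 //; nowrite.
  + rewrite s'_st -r2 /= s_prev h2.
    by case: eqP => [->|_] //; rewrite cat_rcons.
  by exists pre => // xa /r4; rewrite k'.1 //; nowrite.
apply: run_nset; rewrite /= s_prev h0 h2 s_p; split=> [j|j|].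
- by rewrite -r1.
- by rewrite -r2.
have uA := assignment_uniq.
exists (rcons pre (vec r 2, p (vec r 0))); first by rewrite cat_rcons -r3.
move=> xa; rewrite mem_rcons inE /= /upd /=.
apply: write_assoc uA _ _ r4 _ => [yb yb_pre|].
  by rewrite mem_cat r3 mem_cat yb_pre.
by rewrite mem_cat r3 mem_cat /= mem_head orbT.
Qed.

Lemma size_le_code r : valid r -> size r <= code (vec r).
Proof.
elim: r => //= e r IHr /andP[/and4P[lt_e _ _ _] /IHr le_r].
by rewrite code_cons //; have := delta_gt0 d e; lia.
Qed.

Lemma run_traceback s : ready s -> traced s rs ->
  nmem s a_cur 0 = code (vec rs) ->
    (forall i, nmem s a_ndrp i = 0) -> (forall i, nmem s a_nins i = 0) ->
  run n (traceback g) s (fun s' => recorded s' [::]).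
Proof.
move=> rd tr s_cur ndrp0 nins0.
pose I j s' := exists r, [/\ size r = j, valid r, traced s r,
  nmem s' a_cur 0 = code (vec r) & recorded s' r].
apply: (run_while (I := I) (m := size rs)).
- apply: leq_trans (size_le_code v_rs) _; apply/ltnW/code_lt => r; exact:
    valid_vec_le.
- exists rs; split=> //; split=> [i|i|]; rewrite /stored ?ndrp0 ?nins0 //.
  by exists [::].
- move=> j s' /= b_s' k' [[|e r] [/= <- v_r tr_r s'_cur rec_r]].
    by move: b_s'; rewrite s'_cur code_nil.
  have rd' : ready s'.
    apply: (ready_keeps k' _ _ rd); first by nowrite.
    by move=> y; nowrite.
  have [[_ _ s'_p _] _] := rd'; exists (size r) => //.
  have /andP[/and4P[lt_e _ _ _] v_r'] := v_r; have [pe te he tr'] := tr_r.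
  have [kp kt kr] : [/\ nmem s' a_pred = nmem s a_pred,
    nmem s' a_tag = nmem s a_tag &
      forall i, nmem s' (a_reg i) = nmem s (a_reg i)].
    by split=> *; rewrite k'.1 //; nowrite.
  apply: run_seq; apply: run_nset; apply: run_seq; apply: run_nset; apply:
    run_seq.
  rewrite /= /upd /= s'_cur kp kt pe te; set s1 := nset _ _ _ _.
  have s1_prev : nmem s1 a_prev 0 = code (vec r) by [].
  have s1_step : nmem s1 a_step 0 = tag e by [].
  have s1_p : nmem s1 1 = p by [].
  have h1 : holds s1 (code (vec r)) (vec r).
    by move=> i lt_i; rewrite -he // -kr.
  have rec1 : recorded s1 (e :: r) by apply: recorded_eq rec_r.
  pose J t s2 := if tag e < t then recorded s2 r else s2 = s1.
  apply: (run_each_step (I := J)) => [|e' s2 lt_e' k2 J2|s2 k2].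
  + by rewrite /J ltn0.
  + have s2_step : nmem s2 a_step 0 = tag e by rewrite k2.1 //; nowrite.
    apply: run_ifeq => /=; rewrite s2_step; [move/tag_inj=> ee' | move=> ne_e].
      move: J2; rewrite /J -ee' ltnn ltnSn => ->; exact: run_record.
    by rewrite /J ltnS leq_eqVlt; case: eqP => [/ne_e|].
  have lt_tag : tag e < 3 * g by case: (e) lt_e => i /=; lia.
  rewrite /J lt_tag => rec2; apply: run_nset; exists r; split=> //.
  rewrite /= /upd /= k2.1 //; nowrite.
move=> j s' /= b_s' k' [[|e r] [/= _ v_r _ s'_cur rec_r]] //.
have /andP[/and4P[lt_e _ _ _] _] := v_r.
by move: b_s'; rewrite s'_cur code_cons //; have := delta_gt0 d e; lia.
Qed.

Lemma size_drp_le i r : size (drp p i r) <= size r.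
Proof.
by elim: r => //= -[j|j|j] r IHr /=; try case: ifP => _ /=;
  rewrite ?ltnS // leqW.
Qed.

Lemma run_fill s : recorded s [::] ->
  run n (fill g) s (fun s' => written s' assignment).
Proof.
case=> r1 r2 [pre r3 r4]; rewrite cats0 in r3.
have st_drp i : stored s 20 a_ndrp i = drp p i rs by rewrite -r1 cats0.
have st_ins i : stored s 21 a_nins i = ins i rs by rewrite -r2 cats0.
have ndrpE i : nmem s a_ndrp i = size (drp p i rs).
  by rewrite -st_drp size_map size_iota.
have ninsE i : nmem s a_nins i = size (ins i rs).
  by rewrite -st_ins size_map size_iota.
have uA := assignment_uniq.
pose z i := zip (ins i rs) (drp p i rs).
pose L i := kept p rs ++ flatten [seq z j | j <- iota 0 i].
have LS i : L i.+1 = L i ++ z i.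
  by rewrite /L iota0_rcons map_rcons -cats1 flatten_cat /= cats0 catA.
have subL i : i <= g -> {subset L i <= assignment}.
  move=> le_i xa; rewrite !mem_cat => /orP[->//|/flattenP[s1 /mapP[j j_i ->]
    xa_j]].
  apply/orP; right; apply/flattenP; exists (z j) => //; apply: map_f.
  by move: j_i; rewrite !mem_iota; lia.
pose I i s' := written s' (L i).
apply: (run_foreach (I := I)) => //.
  by move=> xa; rewrite /L cats0 r3 => /r4.
move=> i s1 lt_i k1 I1.
have sz : size (ins i rs) = size (drp p i rs) by apply: (size_ins v_rs rs0 rsc).
have szz : size (z i) = size (drp p i rs) by rewrite size2_zip // sz.
have le_drp : size (drp p i rs) <= n.
  apply: leq_trans (size_drp_le _ _) (leq_trans (size_le_code v_rs) _).
  by apply/ltnW/code_lt => r; apply: valid_vec_le.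
pose J x s' := written s' (L i ++ take x (z i)).
apply: (run_for (I := J) (N := size (drp p i rs))) => //.
- by rewrite /J take0 cats0.
- by move=> s2 k2; rewrite /= k2.1 // k1.1 ?ndrpE //; nowrite.
- move=> x s2 lt_x s2_x k2 J2; apply: run_nset.
  have s2_ins : nmem s2 (a_ins i) x = nth 0 (ins i rs) x.
    rewrite k2.1 ?k1.1; [| by nowrite | by nowrite].
    by rewrite -st_ins (nth_map 0) ?size_iota ?nth_iota ?ninsE ?sz.
  have s2_drp : nmem s2 (a_drp i) x = nth 0 (drp p i rs) x.
    rewrite k2.1 ?k1.1; [| by nowrite | by nowrite].
    by rewrite -st_drp (nth_map 0) ?size_iota ?nth_iota ?ndrpE.
  have nz : nth (0, 0) (z i) x = (nth 0 (ins i rs) x, nth 0 (drp p i rs) x).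
    by rewrite nth_zip.
  rewrite /J /written (take_nth (0, 0)) ?szz // -rcons_cat nz => yb.
  rewrite mem_rcons inE /= s2_x s2_ins s2_drp /upd /=.
  have sub1 : {subset L i ++ z i <= assignment} by rewrite -LS; apply: subL.
  apply: write_assoc uA _ _ J2 _ => [xa|].
    rewrite mem_cat => /orP[xa_L|/mem_take xa_z]; apply: sub1; rewrite mem_cat.
      by rewrite xa_L.
    by rewrite xa_z orbT.
  by apply: sub1; rewrite mem_cat -nz mem_nth ?orbT // szz.
by move=> s2 k2; rewrite /J take_oversize ?szz // /I LS.
Qed.

End Trace.


Hypothesis perm_p : perm_eq (map p (iota 0 d)) (iota 0 d).

Lemma run_program s rs1 :
    [/\ nmem s 0 0 = d, nmem s 0 1 = k, nmem s 1 = p & nmem s 2 = lab] ->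
    (forall y j, 3 <= y -> nmem s y j = 0) ->
    (forall i, i < g -> rmem s 0 i = al i) ->
    (forall i, i < g -> rmem s 1 i = be i) ->
    (forall y, 2 <= y -> rmem s y 0 = 0%R) -> complete rs1 ->
  run n (program g) s (fun s' => exists rs, [/\ complete rs,
    forall rs', complete rs' -> vec rs 1 <= vec rs' 1 &
    written s' (assignment g p rs)]).
Proof.
move=> [s_d s_k s_p s_lab] s0 s_al s_be sr0 c1.
apply: run_seq.
apply: run_weaken (run_keeps (run_real_tables s_d s_al s_be sr0)) _ =>
  s1 [[t1 t2 t3] k1].
have k1' y : y != a_idx -> nmem s1 y = nmem s y.
  by move=> y4; rewrite k1.1 //; nowrite.
have s1_d : nmem s1 0 0 = d by rewrite k1'.
have s1_pow r : nmem s1 a_pow r = 0 by rewrite k1' // s0.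
apply: run_seq; apply: run_weaken (run_keeps (run_powers s1_d s1_pow)) _ =>
  s2 [t4 k2].
have k2' y : y != a_idx -> y != a_pow -> nmem s2 y = nmem s y.
  by move=> y4 y5; rewrite k2.1 ?k1' //; nowrite.
have rd2 : ready s2.
  split; first by rewrite !k2'.
  by split=> // *; rewrite k2.2 ?(t1, t2, t3) //; nowrite.
apply: run_seq; apply: run_weaken (run_keeps (run_target rd2 _)) _;
  first by rewrite k2' ?s0.
move=> s3 [t5 k3].
have rd3 : ready s3.
  apply: (ready_keeps k3 _ _ rd2); first by nowrite.
  by move=> y; nowrite.
have k3' y : y != a_idx -> y != a_pow -> y != a_cur -> nmem s3 y = nmem s y.
  by move=> y4 y5 y14; rewrite k3.1 ?k2' //=; rewrite !negb_or y4 y14.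
have s3_seen y : nmem s3 a_seen y = 0 by rewrite k3' ?s0.
have s3_reg r : nmem s3 (a_reg r) 0 = 0 by rewrite k3' ?s0 // /arr; lia.
apply: run_seq; apply: run_weaken (run_keeps (run_search rd3 s3_seen s3_reg)) _
  => s4 [[tab4 all4] k4].
have rd4 : ready s4.
  apply: (ready_keeps k4 _ _ rd3); first by nowrite.
  by move=> y; nowrite.
have s4_cur : nmem s4 a_cur 0 = code (vec (keep_all d)).
  by rewrite k4.1 ?t5 //; nowrite.
apply: run_seq.
apply: run_weaken (run_keeps (run_least_target rd4 tab4 all4 c1 s4_cur)) _.
move=> s5 [[rs [c5 s5_cur min5]] k5].
have k5' y : y != a_cur -> nmem s5 y = nmem s4 y by move=> y14; rewrite k5.1.
have [rs' [v' eq' tr']] : exists rs',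
    [/\ valid rs', forall r, r < g.+3 -> vec rs' r = vec rs r & traced s4 rs'].
  by apply: table_traced => //; [case: c5 | apply: all4; case: c5].
have [_ e0 e2 ec] := c5.
have c' : complete rs' by split=> // [||i lt_i]; rewrite eq' //; apply: ec.
have [_ e0' e2' ec'] := c'.
have ecp i : i < g ->
    vec rs' i.+3 = count (fun a => lab a == i) (map p (iota 0 d)).
  by move=> lt_i; rewrite ec' // (seq.permP perm_p).
have rd5 : ready s5.
  apply: (ready_keeps k5 _ _ rd4); first by nowrite.
  by move=> y; nowrite.
have tr5 : traced s5 rs'.
  elim: (rs') tr' => //= e r IHr [pe te hr /IHr tr_r].
  rewrite !k5' //; split=> // i lt_i; rewrite k5' ?hr //; nowrite.
have z5 y : y \in [:: a_ndrp; a_nins] -> forall i, nmem s5 y i = 0.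
  rewrite !inE => /orP[]/eqP-> i; rewrite k5' // k4.1 ?k3' ?s0 //; nowrite.
have cur5 : nmem s5 a_cur 0 = code (vec rs') by rewrite s5_cur (eq_code _ eq').
apply: run_seq; apply: run_weaken (run_traceback v' e0' e2' ecp rd5 tr5 cur5 _
  _) _.
- exact: z5.
- exact: z5.
move=> s6 rec6; apply: run_weaken (run_fill v' e0' e2' ecp rec6) _ => s7 w7.
by exists rs'; split=> // rs'' c''; rewrite eq' // min5.
Qed.

End Correct.

(** * Correctness of the output *)

Section Instance.
Local Open Scope nat_scope.
Variables (R : archiRealFieldType) (d g k : nat) (pi : 'S_d).
Variables (G : 'I_g -> {set 'I_d}) (alpha beta : 'I_g -> R).
Hypothesis grpG : is_grouping G.

Definition rank_fun (tau : 'S_d) : nat -> nat :=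
  cells 0 (fun i : 'I_d => tau i : nat).

Definition label : nat -> nat :=
  cells 0 (fun a : 'I_d => oapp (@nat_of_ord g) 0 [pick i | a \in G i]).

Lemma cellsE (T : Type) (z : T) (n : nat) (f : 'I_n -> T) (i : 'I_n) :
  cells z f i = f i.
Proof. by rewrite /cells valK. Qed.

Lemma word_rank_fun (tau : 'S_d) :
  map val (word tau) = map (rank_fun tau) (iota 0 d).
Proof.
rewrite -val_enum_ord /word /image_mem enumT -!map_comp; apply: eq_map => i /=.
by rewrite /rank_fun cellsE.
Qed.

Lemma perm_rank_fun (tau : 'S_d) : perm_eq (map (rank_fun tau) (iota 0 d))
  (iota 0 d).
Proof.
rewrite -word_rank_fun -val_enum_ord perm_map // uniq_perm ?word_uniq
  ?enum_uniq //.
by move=> x; rewrite mem_word mem_enum.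
Qed.

Lemma label_group (a : 'I_d) (i : 'I_g) : (label a == i) = (a \in G i).
Proof.
rewrite /label cellsE; case: pickP => [j aj|none] /=; last first.
  have : a \in \bigcup_i G i by rewrite grpG.2 inE.
  by case/bigcupP=> j _; rewrite none.
apply/eqP/idP => [ji|ai]; first by rewrite -(val_inj ji).
congr val; apply/eqP; apply: contraLR isT => ne_ji.
by have /pred0P/(_ a) := grpG.1 _ _ ne_ji; rewrite /= aj ai.
Qed.

Lemma label_lt a : a < d -> label a < g.
Proof.
move=> lt_a; have : Ordinal lt_a \in \bigcup_i G i by rewrite grpG.2 inE.
by case/bigcupP=> i _; rewrite -label_group => /eqP /= ->.
Qed.

Lemma rank_fun_lt (tau : 'S_d) j : j < d -> rank_fun tau j < d.
Proof. by move=> lt_j; rewrite /rank_fun (cellsE _ _ (Ordinal lt_j)). Qed.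

Lemma card_top (tau : 'S_d) m (i : 'I_g) : m <= d ->
  #|top tau m :&: G i|
  = count (fun a => label a == i) (map (rank_fun tau) (iota 0 m)).
Proof.
move=> le_m; have -> : top tau m :&: G i = tau @: [set x : 'I_d | (x < m) &&
  (tau x \in G i)].
  apply/setP=> y; apply/setIP/imsetP => [[/imsetP[x]]|[x]]; rewrite inE.
    by move=> lt_x -> xi; exists x; rewrite // inE lt_x.
  by case/andP=> lt_x xi ->; split=> //; apply: imset_f; rewrite inE.
rewrite card_imset; last exact: perm_inj.
rewrite count_map -sum1_count -sum1_card -{2}[m]subn0 -/(index_iota 0 m).
rewrite big_mkord (big_ord_widen_cond d (fun x =>
  label (rank_fun tau x) == i) (fun=> 1)) //.
apply: eq_bigl => x; rewrite inE andbC -label_group.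
by rewrite /rank_fun cellsE.
Qed.

Local Notation fairv := (fair_state g k (cells 0%R alpha) (cells 0%R beta)).

Lemma fair_stateP (v : nat -> nat) : reflect
  (k <= v 2 -> forall i : 'I_g, (Num.floor (alpha i * (v 2)%:R)
     <= (v i.+3)%:Z <= Num.ceil (beta i * (v 2)%:R))%R) (fairv v).
Proof.
have eqv (i : 'I_g) : (Num.floor (alpha i * (v 2)%:R) <= (v i.+3)%:Z
      <= Num.ceil (beta i * (v 2)%:R))%R =
    ~~ ((v i.+3)%:R + 1 <= cells 0%R alpha i *+ v 2)%R
    && ~~ (cells 0%R beta i *+ v 2 + 1 <= (v i.+3)%:R)%R.
  rewrite !cellsE !mulr_natr -!ltNge; congr andb.
    by rewrite -ltzD1 floor_lt_int intrD.
  by rewrite -[leLHS](subrK 1%R) lezD1 ceil_gt_int intrB ltrBlDr.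
apply: (iffP implyP) => [f km i|f km].
  by rewrite eqv; apply: (allP (f km)); rewrite mem_iota /=.
apply/allP => i; rewrite mem_iota => /andP[_ lt_i].
by have := f km (Ordinal lt_i); rewrite eqv.
Qed.

Local Notation followed tau := (follows g label (rank_fun tau)).

Lemma fair_follows (tau : 'S_d) (v : nat -> nat) :
  strict_fair G alpha beta k tau -> v 2 <= d -> followed tau v -> fairv v.
Proof.
move=> fair_tau le_v fol; apply/fair_stateP => km i.
by rewrite fol // -card_top //; apply: fair_tau; rewrite km.
Qed.

Local Notation complete := (complete g d k (rank_fun pi) label (cells 0%R
  alpha) (cells 0%R beta)).

Lemma complete_of_fair (tau : 'S_d) : strict_fair G alpha beta k tau ->
  exists2 rs, complete rs & vec rs 1 <= ulam pi tau.
Proof.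
move=> fair_tau; have [A [Api Atau le_A]] := ulam_common pi tau.
have subn (sg : 'S_d) : subseq A (word sg) ->
    subseq (map val A) (map (rank_fun sg) (iota 0 d)).
  by move=> sub; rewrite -word_rank_fun map_subseq.
have lab_rank (sg : 'S_d) j : j < d -> label (rank_fun sg j) < g.
  by move=> lt_j; apply/label_lt/rank_fun_lt.
have fq v : v 2 <= d -> followed tau v -> fairv v by apply: fair_follows.
have [rs [v0 e0 e2 fol le_rs]] :=
  valid_of_common (lab_rank pi) (lab_rank tau) fq (subn _ Api) (subn _ Atau).
exists rs.
  split=> // i lt_i; rewrite fol // e2.
  exact/seq.permP/perm_rank_fun.
rewrite size_map in le_rs; rewrite -(leq_add2r (size A)).
by apply: leq_trans le_rs _; rewrite addnC.
Qed.

Lemma subseq_map_val (s : seq nat) (t : seq 'I_d) : subseq s (map val t) ->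
  exists2 s' : seq 'I_d, s = map val s' & subseq s' t.
Proof.
case/subseqP=> m _ ->; exists (mask m t); first by rewrite map_mask.
exact: mask_subseq.
Qed.

Lemma assignment_perm (rs : seq step) (out : nat -> nat) : complete rs ->
    (forall xa, xa \in assignment g (rank_fun pi) rs -> out xa.1 = xa.2) ->
  exists2 sg : 'S_d, forall x : 'I_d, out x = sg x &
    forall x : 'I_d, (x : nat, sg x : nat) \in assignment g (rank_fun pi) rs.
Proof.
move=> [v e0 e2 ec] outE; set L := assignment _ _ _ in outE *.
have ecp i : i < g -> vec rs i.+3 =
    count (fun a => label a == i) (map (rank_fun pi) (iota 0 d)).
  by move=> lt_i; rewrite ec //; apply/esym/seq.permP/perm_rank_fun.
have pos := assignment_positions v e0 e2 ecp.
have cand := perm_trans (assignment_candidates v e0 ecp) (perm_rank_fun pi).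
have memL (x : 'I_d) : (x : nat, out x) \in L.
  have /mapP[[y a] ya xy] : (x : nat) \in unzip1 L by rewrite (perm_mem pos)
    mem_iota /=.
  by rewrite /= in xy; rewrite xy [out y](outE _ ya).
have lt_out (x : 'I_d) : out x < d.
  have : out x \in unzip2 L by apply: (map_f snd (memL x)).
  by rewrite (perm_mem cand) mem_iota.
pose f x := Ordinal (lt_out x).
have inj_f : injective f.
  move=> x y /(congr1 val) /= xy; apply: val_inj.
  have u2 : uniq (unzip2 L) by rewrite (perm_uniq cand) iota_uniq.
  pose L' := [seq (xa.2, xa.1) | xa <- L].
  have uL' : uniq (unzip1 L') by rewrite /unzip1 -map_comp.
  apply: (@assoc_uniq L' (out x)) => //; first exact: (map_f _ (memL x)).
  by rewrite xy; apply: (map_f _ (memL y)).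
by exists (perm inj_f) => x; rewrite permE //=.
Qed.

Lemma cols_assignment (rs : seq step) (sg : 'S_d) : complete rs ->
    (forall x : 'I_d, (x : nat, sg x : nat) \in assignment g (rank_fun pi) rs) ->
  cols rs = map label (map (rank_fun sg) (iota 0 d)).
Proof.
move=> [v e0 e2 ec] memL; rewrite -map_comp.
apply: (@eq_from_nth _ 0) => [|x]; rewrite size_cols e2 ?size_map ?size_iota //.
move=> lt_x; rewrite (nth_map 0) ?size_iota // nth_iota //=.
rewrite -(assignment_cols v (memL (Ordinal lt_x))) /= add0n.
by rewrite -[in RHS]/(nat_of_ord (Ordinal lt_x)) /rank_fun cellsE.
Qed.

Lemma fair_assignment (rs : seq step) (tau sg : 'S_d) : complete rs ->
    (forall x : 'I_d, (x : nat, sg x : nat) \in assignment g (rank_fun pi) rs) ->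
    strict_fair G alpha beta k tau ->
  strict_fair G alpha beta k sg.
Proof.
move=> c memL fair_tau m /andP[km le_m] i; have colsE := cols_assignment c memL.
have [v e0 e2 ec] := c; have [lt_m|ge_m] := ltnP m d.
  have [|rs' [f' m' c']] := cols_prefix (m := m) v; first by rewrite e2.
  have /fair_stateP/(_ _ i) := f'; rewrite m' => /(_ km).
  rewrite card_top ?(ltnW lt_m) // -count_cols c' colsE -!map_take take_iota.
  by rewrite (minn_idPl (ltnW lt_m)) !count_map.
have eq_m : m = d by apply/eqP; rewrite eqn_leq le_m.
have := fair_tau m; rewrite km le_m => /(_ isT i).
by rewrite !card_top // eq_m !(seq.permP (perm_rank_fun _)).
Qed.

Lemma ulam_assignment (rs : seq step) (sg : 'S_d) : complete rs ->
    (forall x : 'I_d, (x : nat, sg x : nat) \in assignment g (rank_fun pi) rs) ->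
  ulam pi sg <= vec rs 1.
Proof.
move=> [v e0 e2 ec] memL; have [sub2 sub0] := kept_subseq (rank_fun pi) rs.
have ecp i : i < g -> vec rs i.+3 =
    count (fun a => label a == i) (map (rank_fun pi) (iota 0 d)).
  by move=> lt_i; rewrite ec //; apply/esym/seq.permP/perm_rank_fun.
have uL := assignment_uniq v e0 e2 ecp.
have keptE : map (rank_fun sg) (rev (unzip1 (kept (rank_fun pi) rs)))
    = rev (unzip2 (kept (rank_fun pi) rs)).
  rewrite map_rev -map_comp; congr rev; apply/eq_in_map => -[x a] xa /=.
  have [lt_x _] := kept_cols v xa; rewrite e2 /= in lt_x.
  apply: (assoc_uniq uL (x := x)); last by rewrite mem_cat xa.
  by have := memL (Ordinal lt_x); rewrite /rank_fun (cellsE _ _ (Ordinal lt_x)).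
rewrite e0 -word_rank_fun in sub0; have [A AE Api] := subseq_map_val sub0.
have Asg : subseq A (word sg).
  have : subseq (map val A) (map val (word sg)).
    by rewrite -AE -keptE word_rank_fun map_subseq // -[X in iota 0 X]e2.
  by case/subseq_map_val=> A' /(inj_map val_inj) ->.
apply: leq_trans (ulam_le_common Api Asg) _.
rewrite -(size_map val) -AE size_rev size_map leq_subLR.
by rewrite size_kept e2.
Qed.

End Instance.

Local Open Scope ring_scope.

Theorem theorem3 (g : nat) :
  exists (c : cmd) (q : {poly nat}),
  forall (R : archiRealFieldType) (d : nat) (pi : 'S_d)
    (G : 'I_g -> {set 'I_d}) (alpha beta : 'I_g -> R) (k : nat),
    is_grouping G ->
    (forall i : 'I_g, 0 <= alpha i <= 1) ->
    (forall i : 'I_g, 0 <= beta i <= 1) ->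
    (1 <= k <= d)%N ->
    (exists tau : 'S_d, strict_fair G alpha beta k tau) ->
    exists (sg : 'S_d) (t : nat) (s : store R),
      [/\ exec c (input pi G alpha beta k) t s,
          (t <= q.[d])%N,
          output_is s sg &
          closest_fair G alpha beta k pi sg].
Proof.
exists (program g), (time_poly (program g) \Po ('X + 1) ^+ g.+3).
move=> R d pi G alpha beta k grpG _ _ _ [tau fair_tau].
have [rs1 c1 _] := complete_of_fair pi grpG fair_tau.
have lab_lt a : (a < d)%N -> (label G a < g)%N by apply: label_lt.
have [|y j|||y|t [s [ex le_t [rs [c min_rs out]]]]] :=
  run_program lab_lt (perm_rank_fun pi) (s := input pi G alpha beta k) _
    _ _ _ _ c1.
- by [].
- by case: y => [|[|[|y]]].
- by [].
- by [].
- by case: y => [|[|y]].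
have [sg sgE memL] := assignment_perm c out.
exists sg, t, s; split=> //.
  rewrite horner_comp time_polyE; suff <- : (d.+1 ^ g.+3)%N = (('X + 1) ^+
    g.+3).[d] by [].
  rewrite horner_exp !hornerE.
  by rewrite natrXE natrDE addn1.
split=> [|tau' fair_tau']; first exact: fair_assignment c memL fair_tau.
have [rs' c' le_rs'] := complete_of_fair pi grpG fair_tau'.
apply: leq_trans (ulam_assignment c memL) _.
exact: leq_trans (min_rs _ c') le_rs'.
Qed.
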